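(* Let $(\mathcal{A},\varphi)$ be a $C^*$-probability space and let $\mathbb{X}\in\mathcal{A}$ be an invertible self-adjoint element that is free Poisson distributed with parameters $(\lambda,1)$, where $\lambda>1$. Let $m\ge 1$ and let $i_1,\dots,i_m\ge 0$ be integers. Then $$\mathcal{R}_{i_1+\cdots+i_m+m}\bigl(\mathbb{X}^{-1},\underbrace{\mathbb{X},\ldots,\mathbb{X}}_{i_1},\mathbb{X}^{-1},\underbrace{\mathbb{X},\ldots,\mathbb{X}}_{i_2},\mathbb{X}^{-1},\ldots,\mathbb{X}^{-1},\underbrace{\mathbb{X},\ldots,\mathbb{X}}_{i_m}\bigr)$$ $$=\begin{cases}0 & \text{if } i_k>1 \text{ for some } k\in\{1,\ldots,m\},\\ (-1)^{i_1+\cdots+i_m}\,\mathcal{R}_m(\mathbb{X}^{-1}) & \text{if } i_k\le 1 \text{ for all } k\in\{1,\ldots,m\}.\end{cases}$$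
   Context: A $C^*$-probability space is a pair $(\mathcal{A},\varphi)$ with $\mathcal{A}$ a unital $C^*$-algebra with unit $\mathbb{I}$ and $\varphi:\mathcal{A}\to\mathbb{C}$ linear with $\varphi(\mathbb{I})=1$ and $\varphi(\mathbb{X}^*\mathbb{X})\ge 0$ for all $\mathbb{X}$. The distribution of a self-adjoint $\mathbb{X}\in\mathcal{A}$ is the probability measure $\mu$ on $\mathbb{R}$ with $\varphi(\mathbb{X}^r)=\int t^r\,\mu(dt)$ for all $r\ge 1$. Free cumulants: $NC(m)$ is the set of non-crossing partitions of $\{1,\dots,m\}$. The (joint) free cumulants are the $k$-linear maps $\mathcal{R}_k:\mathcal{A}^k\to\mathbb{C}$, $k\ge1$, defined recursively by $$\varphi(\mathbb{X}_1\cdots\mathbb{X}_m)=\sum_{\chi\in NC(m)}\prod_{B\in\chi}\mathcal{R}_{|B|}(\mathbb{X}_i,\ i\in B),\qquad m\ge 1,$$ where within each block the arguments are taken in increasing order of index. One writes $\mathcal{R}_m(\mathbb{Z})=\mathcal{R}_m(\mathbb{Z},\dots,\mathbb{Z})$ ($m$ copies). Free Poisson distribution: for $\lambda>1$ and $\alpha>0$, the free Poisson law with parameters $(\lambda,\alpha)$ is the probability measure supported on $(\alpha(1-\sqrt\lambda)^2,\alpha(1+\sqrt\lambda)^2)$ with density $\frac{1}{2\pi\alpha x}\sqrt{4\lambda\alpha^2-(x-\alpha(1+\lambda))^2}$ with respect to Lebesgue measure. *)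

(* Defs.v *)
From HB Require Import structures.
From mathcomp Require Import all_boot all_order all_algebra.
From mathcomp Require Import complex.
From mathcomp Require Import all_classical all_reals all_analysis.

Set Implicit Arguments.
Unset Strict Implicit.
Unset Printing Implicit Defensive.

Import Order.TTheory GRing.Theory Num.Theory.
Import numFieldNormedType.Exports.

Local Open Scope complex_scope.
Local Open Scope ring_scope.

(* The library has no structure joining rings and normed modules, so the norm
   and its completeness are part of the mixin over the algebra structure. *)
HB.mixin Record Algebra_isCStar (R : realType) A of GRing.Algebra R[i] A := {
  star : A -> A;
  cnorm : A -> R;
  starD : forall x y : A, star (x + y) = star x + star y;
  starZ : forall (c : R[i]) (x : A), star (c *: x) = c^* *: star x;
  starM : forall x y : A, star (x * y) = star y * star x;
  starK : forall x : A, star (star x) = x;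
  cnorm_eq0 : forall x : A, cnorm x = 0 -> x = 0;
  cnormD : forall x y : A, cnorm (x + y) <= cnorm x + cnorm y;
  cnormZ : forall (c : R[i]) (x : A),
    cnorm (c *: x) = Normc.normc c * cnorm x;
  cnormM : forall x y : A, cnorm (x * y) <= cnorm x * cnorm y;
  cnorm_cstar : forall x : A, cnorm (star x * x) = cnorm x ^+ 2;
  cnorm_complete : forall u : nat -> A,
    (forall e : R, 0 < e -> exists N : nat, forall p q : nat,
       (N <= p)%N -> (N <= q)%N -> cnorm (u p - u q) < e) ->
    exists l : A, forall e : R, 0 < e -> exists N : nat, forall n : nat,
       (N <= n)%N -> cnorm (u n - l) < e }.

#[short(type="cstarAlgType")]
HB.structure Definition CStarAlgebra (R : realType) :=
  {A of GRing.Algebra R[i] A & Algebra_isCStar R A}.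

(* [0 <= z] in R[i] means that z is real and nonnegative. *)
Record state (R : realType) (A : cstarAlgType R) := State {
  state_fun :> {scalar A};
  state1 : state_fun 1 = 1;
  state_ge0 : forall x : A, 0 <= state_fun (star x * x) }.

Definition is_inverse (A : pzRingType) (x y : A) : Prop :=
  x * y = 1 /\ y * x = 1.

Definition noncrossing (m : nat) (P : {set {set 'I_m}}) : bool :=
  [forall B in P, forall B' in P, (B != B') ==>
    [forall a in B, forall b in B', forall c in B, forall d in B',
       ~~ [&& (a < b)%N, (b < c)%N & (c < d)%N]]].

Definition NC (m : nat) : {set {set {set 'I_m}}} :=
  [set P : {set {set 'I_m}} | finset.partition P [set: 'I_m] & noncrossing P].

(* [enum B] lists B in increasing order. *)
Definition restrict (T : Type) (s : seq T) (B : {set 'I_(size s)}) : seq T :=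
  [seq tnth (in_tuple s) i | i <- enum B].
Arguments restrict {T} s B.

Section FreeCumulants.
Variables (R : realType) (A : cstarAlgType R) (phi : state A).

(* The moment-cumulant formula solved for the term of the one-block partition;
   [n] bounds the depth of the recursion. *)
Fixpoint free_cumulant_rec (n : nat) (s : seq A) : R[i] :=
  if n is n'.+1 then
    phi (\prod_(x <- s) x) -
    \sum_(P in NC (size s) | P != [set [set: 'I_(size s)]]%SET)
      \prod_(B in P) free_cumulant_rec n' (restrict s B)
  else 0.

(* R_k(x_1, ..., x_k) is [free_cumulant [:: x_1; ...; x_k]]. *)
Definition free_cumulant (s : seq A) : R[i] := free_cumulant_rec (size s) s.

End FreeCumulants.

Lemma proper_block (m : nat) (P : {set {set 'I_m}}) (B : {set 'I_m}) :
  P \in NC m -> P != [set [set: 'I_m]]%SET -> B \in P -> (#|B| < m)%N.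
Proof.
rewrite inE => /andP[/and3P[/eqP covP trivP P0] _] PT BP.
rewrite ltn_neqAle; apply/andP; split; last by rewrite -[leqRHS]card_ord max_card.
apply: contra PT => /eqP cB.
have BT : B = [set: 'I_m]%SET.
  by apply/eqP; rewrite eqEcard finset.subsetT cardsT card_ord cB leqnn.
apply/eqP/finset.setP => D; rewrite inE; apply/idP/eqP => [DP|->]; last first.
  by rewrite -BT.
apply/eqP; apply: contraT => DB.
have := finset.trivIsetP trivP _ _ DP BP; rewrite BT => /(_ DB).
rewrite -setI_eq0 finset.setIT => /eqP D0.
by move: P0; rewrite -D0 DP.
Qed.

Lemma block_neq0 (m : nat) (P : {set {set 'I_m}}) (B : {set 'I_m}) :
  P \in NC m -> B \in P -> B != finset.set0.
Proof.
by rewrite inE => /andP[/and3P[_ _ P0] _] BP; apply: contraNneq P0 => <-.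
Qed.

Lemma one_block_NC (m : nat) : (0 < m)%N -> [set [set: 'I_m]]%SET \in NC m.
Proof.
move=> m0; rewrite inE; apply/andP; split.
  apply/and3P; split.
  - by rewrite /finset.cover big_set1.
  - by apply/finset.trivIsetP => B D; rewrite !inE => /eqP -> /eqP ->; rewrite eqxx.
  - by rewrite inE eq_sym -card_gt0 cardsT card_ord.
apply/'forall_implyP => B; rewrite inE => /eqP ->.
apply/'forall_implyP => D; rewrite inE => /eqP ->.
by rewrite eqxx.
Qed.

Lemma size_restrict (T : Type) (s : seq T) B : size (restrict s B) = #|B|.
Proof. by rewrite size_map -cardE. Qed.

Lemma restrictT (T : Type) (s : seq T) : restrict s [set: 'I_(size s)] = s.
Proof.
rewrite /restrict; have -> : enum [set: 'I_(size s)] = enum 'I_(size s).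
  by rewrite /enum_mem; apply: eq_filter => i; rewrite !inE.
by have := map_tnth_enum (in_tuple s).
Qed.

Section FreeCumulantTheory.
Variables (R : realType) (A : cstarAlgType R) (phi : state A).
Local Notation fc := (free_cumulant phi).

Lemma free_cumulant_recE (n : nat) (s : seq A) :
  (size s <= n)%N -> free_cumulant_rec phi n s = fc s.
Proof.
rewrite /free_cumulant; elim/ltn_ind: n s => -[|n] IH s.
  by rewrite leqn0 => /eqP ->.
have [/size0nil -> _|s0 sn] := posnP (size s).
  rewrite /= big_nil state1.
  have NC0 (P : {set {set 'I_0}}) : (P \in NC 0) = (P == finset.set0).
    rewrite !inE; apply/idP/eqP => [/andP[/and3P[_ _ P0] _]|->].
      apply/finset.setP => B; rewrite inE; apply/negP => BP.
      suff B0 : B = finset.set0 by rewrite B0 (negbTE P0) in BP.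
      by apply/finset.setP => -[].
    apply/andP; split; last by apply/'forall_implyP => B; rewrite inE.
    apply/and3P; split; rewrite ?inE //.
      by apply/eqP/finset.setP => -[].
    by apply/finset.trivIsetP => B D; rewrite inE.
  rewrite (big_pred1 finset.set0) ?big_set0 ?subrr // => P.
  rewrite NC0; have [->|/eqP P0] /= := eqVneq P finset.set0; last exact/esym/eqP.
  by rewrite eq_sym eqxx -card_gt0 cards1.
rewrite -{1}(prednK s0) /=; congr (_ - _); apply: eq_bigr => P /andP[PNC PT].
apply: eq_bigr => B BP.
have bs : (#|B| <= (size s).-1)%N.
  by rewrite -ltnS prednK //; exact: proper_block PNC PT BP.
have sn' : ((size s).-1 <= n)%N by rewrite -ltnS prednK.
by rewrite !IH ?size_restrict // (leq_trans bs).
Qed.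

Lemma free_cumulantE (s : seq A) : (0 < size s)%N ->
  fc s = phi (\prod_(x <- s) x) -
    \sum_(P in NC (size s) | P != [set [set: 'I_(size s)]]%SET)
      \prod_(B in P) fc (restrict s B).
Proof.
move=> s0; rewrite /free_cumulant -{1}(prednK s0) /=.
congr (_ - _); apply: eq_bigr => P /andP[PNC PT].
apply: eq_bigr => B BP; rewrite free_cumulant_recE // size_restrict.
by rewrite -ltnS prednK //; exact: proper_block PNC PT BP.
Qed.

Lemma moment_cumulant (s : seq A) : (0 < size s)%N ->
  phi (\prod_(x <- s) x) =
  \sum_(P in NC (size s)) \prod_(B in P) fc (restrict s B).
Proof.
move=> s0; rewrite (bigD1 _ (one_block_NC s0)) /= big_set1 restrictT.
by rewrite free_cumulantE // subrK.
Qed.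

Lemma moment_cumulant_unique (K : seq A -> R[i]) :
  (forall s : seq A, (0 < size s)%N ->
     phi (\prod_(x <- s) x) =
     \sum_(P in NC (size s)) \prod_(B in P) K (restrict s B)) ->
  forall s : seq A, (0 < size s)%N -> K s = fc s.
Proof.
move=> HK s; move n_s : (size s) => n; elim/ltn_ind: n s n_s => n IH s sn n0.
have s0 : (0 < size s)%N by rewrite sn.
have := HK s s0; rewrite (bigD1 _ (one_block_NC s0)) /= big_set1 restrictT.
rewrite free_cumulantE // => ->; rewrite -addrA -[LHS]addr0; congr (_ + _).
apply/esym/eqP; rewrite subr_eq0; apply/eqP; apply: eq_bigr => P /andP[PNC PT].
apply: eq_bigr => B BP; have bl := proper_block PNC PT BP.
apply: (IH #|B|); rewrite -?sn ?size_restrict // card_gt0.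
exact: block_neq0 PNC BP.
Qed.

Lemma prod_slot (I : eqType) (r : seq I) (F G H : I -> A) (j : I) (a : R[i]) :
  uniq r -> j \in r -> F j = a *: G j + H j ->
  (forall i, i != j -> F i = G i) -> (forall i, i != j -> F i = H i) ->
  \prod_(i <- r) F i = a *: \prod_(i <- r) G i + \prod_(i <- r) H i.
Proof.
move=> + + Fj FG FH; elim: r => //= i r IH /andP[ir ur].
rewrite in_cons => jir; rewrite !big_cons; have [ij|ij] := eqVneq i j.
  have jr : j \notin r by rewrite -ij.
  have eqr (K : I -> A) : (forall k, k != j -> F k = K k) ->
      \prod_(k <- r) F k = \prod_(k <- r) K k.
    by move=> FK; apply: eq_big_seq => k kr; apply: FK; apply: contraNneq jr => <-.
  by rewrite ij Fj mulrDl -scalerAl -(eqr _ FG) -(eqr _ FH).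
have jr : j \in r by move: jir; rewrite eq_sym (negbTE ij).
by rewrite IH // mulrDr -scalerAr -FG // -FH.
Qed.

Lemma free_cumulant_tupleE (m : nat) (t : m.-tuple A) : (0 < m)%N ->
  fc t = phi (\prod_(i <- enum 'I_m) tnth t i) -
    \sum_(P in NC m | P != [set [set: 'I_m]]%SET)
      \prod_(B in P) fc [seq tnth t i | i <- enum B].
Proof.
case: t => s sm; have sm' := eqP sm; subst m => s0.
rewrite free_cumulantE //=; congr (phi _ - _).
  rewrite -(big_map (tnth (Tuple sm)) xpredT id).
  by rewrite map_tnth_enum.
apply: eq_bigr => P _; apply: eq_bigr => B _; congr (fc _).
by apply: eq_map => i; rewrite !(tnth_nth 0).
Qed.

Lemma free_cumulant_slot (m : nat) (t t1 t2 : m.-tuple A) (j : 'I_m) (a : R[i]) :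
  tnth t j = a *: tnth t1 j + tnth t2 j ->
  (forall i, i != j -> tnth t i = tnth t1 i) ->
  (forall i, i != j -> tnth t i = tnth t2 i) ->
  fc t = a * fc t1 + fc t2.
Proof.
elim/ltn_ind: m t t1 t2 j => m IH t t1 t2 j tj tt1 tt2.
have m0 : (0 < m)%N by apply: leq_ltn_trans (ltn_ord j).
rewrite !free_cumulant_tupleE //.
rewrite (@prod_slot _ _ _ (tnth t1) (tnth t2) j a) ?enum_uniq ?mem_enum //.
rewrite linearP /= mulrBr addrACA -opprD; congr (_ - _).
rewrite mulr_sumr -big_split /=; apply: eq_bigr => P /andP[PNC PT].
have /andP[partP _] : finset.partition P [set: 'I_m] && noncrossing P.
  by move: PNC; rewrite inE.
have covj : j \in finset.cover P by rewrite (cover_partition partP) inE.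
have BP : finset.pblock P j \in P by rewrite pblock_mem.
have jB : j \in finset.pblock P j by rewrite mem_pblock.
set B := finset.pblock P j in BP jB.
rewrite !(bigD1 B BP) /=.
have eqD (t' : m.-tuple A) : (forall i, i != j -> tnth t i = tnth t' i) ->
    \prod_(D in P | D != B) fc [seq tnth t i | i <- enum D] =
    \prod_(D in P | D != B) fc [seq tnth t' i | i <- enum D].
  move=> tt'; apply: eq_bigr => D /andP[DP DB]; congr (fc _).
  apply/eq_in_map => i; rewrite mem_enum => iD; apply: tt'.
  apply: contraNneq DB => ij; move: iD; rewrite ij => jD.
  have /and3P[_ trivP _] := partP.
  by rewrite /B (def_pblock trivP DP jD).
rewrite -(eqD _ tt1) -(eqD _ tt2) mulrA -mulrDl; congr (_ * _).
have jr : (index j (enum B) < #|B|)%N by rewrite cardE index_mem mem_enum.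
have sz (t' : m.-tuple A) : size [seq tnth t' i | i <- enum B] == #|B|.
  by rewrite size_map -cardE.
have nthB (t' : m.-tuple A) (k : 'I_#|B|) :
    tnth (Tuple (sz t')) k = tnth t' (nth j (enum B) k).
  by rewrite (tnth_nth 0) /= (nth_map j) // -cardE.
have nthj : nth j (enum B) (index j (enum B)) = j by rewrite nth_index ?mem_enum.
have nej (k : 'I_#|B|) : k != Ordinal jr -> nth j (enum B) k != j.
  apply: contraNneq => kj; apply/eqP/val_inj => /=.
  by rewrite -[in RHS]kj index_uniq ?enum_uniq // -cardE.
apply: (IH _ (proper_block PNC PT BP) (Tuple (sz t)) (Tuple (sz t1))
          (Tuple (sz t2)) (Ordinal jr)).
- by rewrite !nthB /= nthj.
- by move=> k kj; rewrite !nthB tt1 ?nej.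
- by move=> k kj; rewrite !nthB tt2 ?nej.
Qed.

Lemma free_cumulant_multilinear (s1 s2 : seq A) (x y : A) (a : R[i]) :
  fc (s1 ++ (a *: x + y) :: s2) = a * fc (s1 ++ x :: s2) + fc (s1 ++ y :: s2).
Proof.
have sz z : size (s1 ++ z :: s2) == (size s1 + (size s2).+1)%N by rewrite size_cat.
have jr : (size s1 < size s1 + (size s2).+1)%N by rewrite addnS ltnS leq_addr.
have ne z z' (k : 'I_(size s1 + (size s2).+1)) : k != Ordinal jr ->
    tnth (Tuple (sz z)) k = tnth (Tuple (sz z')) k.
  move=> kj; rewrite !(tnth_nth 0) /= !nth_cat; case: ltnP => // k1.
  have : (0 < k - size s1)%N.
    by rewrite subn_gt0 ltn_neqAle k1 andbT eq_sym.
  by case: (k - size s1)%N.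
apply: (@free_cumulant_slot _ (Tuple (sz _)) (Tuple (sz x)) (Tuple (sz y))
          (Ordinal jr)).
- by rewrite !(tnth_nth 0) /= !nth_cat ltnn subnn.
- by move=> k; exact: ne.
- by move=> k; exact: ne.
Qed.

End FreeCumulantTheory.

Section FreePoisson.
Variable R : realType.
Implicit Types (lam alpha : R).

Definition free_poisson_pdf lam alpha (x : R) : R :=
  if (alpha * (1 - Num.sqrt lam) ^+ 2 < x < alpha * (1 + Num.sqrt lam) ^+ 2)
  then (2 * pi * alpha * x)^-1 *
       Num.sqrt (4 * lam * alpha ^+ 2 - (x - alpha * (1 + lam)) ^+ 2)
  else 0.

Definition is_free_poisson lam alpha
    (mu : probability (measurableTypeR R) R) : Prop :=
  forall U : set (measurableTypeR R), measurable U ->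
    mu U = (\int[lebesgue_measure]_(x in U) (free_poisson_pdf lam alpha x)%:E)%E.

Definition has_distribution (A : cstarAlgType R) (phi : state A) (X : A)
    (mu : probability (measurableTypeR R) R) : Prop :=
  forall r : nat, (0 < r)%N ->
    mu.-integrable setT (fun t : R => (t ^+ r)%:E) /\
    phi (X ^+ r) = (Rintegral mu setT (fun t : R => t ^+ r))%:C.

Definition free_poisson_distributed (A : cstarAlgType R) (phi : state A) (X : A)
    lam alpha : Prop :=
  exists2 mu : probability (measurableTypeR R) R,
    is_free_poisson lam alpha mu & has_distribution phi X mu.

End FreePoisson.

(* Main.v *)
Require Import Defs.
From HB Require Import structures.
From mathcomp Require Import all_boot all_order all_algebra.
From mathcomp Require Import zify ring lra.
From mathcomp Require Import reals complex.

(**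
The moment-cumulant formula, grouped by the block of the first letter, reads
M(a w) = sum over subwords v of w of K(a v) times the moments of the gaps, and
it determines K. Since X^-1 X = 1, comparing it with M(w) = M(X^-1 X w) gives
   K(X^-1 X v) = [v is empty] - sum_{v = v1 v2} K(X v1) K(X^-1 v2),
and since moments are invariant under rotation, so is K. Every word containing
both letters can be rotated to the form X^-1 X v, so the theorem follows by
induction on the length from
   K(X, ..., X) = lam,
   (lam - 1) k_(n+1) = [n = 0] + sum_{i < n} k_(i+1) k_(n-i),  k_m = R_m(X^-1).
The two equations amount to quadratic recurrences for the moments of X and of
X^-1. The first one is the last passage decomposition of the entries of a
tridiagonal Toeplitz matrix, which the substitution t = 1 + lam + 2 sqrt(lam) cos x
identifies with the moments of the free Poisson law. The moments of X^-1 are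
not given by the hypothesis on the distribution of X. With S = X - (1 + lam),
the numbers phi(X^-k S^a) are O((2 sqrt lam)^a) by the Cauchy-Schwarz
inequality for phi; as 2 sqrt lam < 1 + lam, the relation
X^-(k+1) S^(a+1) + (1 + lam) X^-(k+1) S^a = X^-k S^a then determines them and
transfers the quadratic recurrence from k = 0 to all k.
*)

Set Implicit Arguments.
Unset Strict Implicit.
Unset Printing Implicit Defensive.

Import Order.TTheory GRing.Theory Num.Theory.

Local Open Scope ring_scope.

(** * Sums over the block of the first letter *)

Section BlockSums.
Variables (T : Type) (C : comNzRingType) (M : seq T -> C).
Implicit Types (h k m l : seq T -> C) (w v : seq T).

(* The sum over the subwords v of w of h v times the moments of the gaps left
   in w by v; the first gap, whose beginning may already have been read, is
   weighed by m instead of M. *)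
Fixpoint block_sum h m w : C :=
  if w is s :: w' then
    m [::] * block_sum (fun v => h (s :: v)) M w'
    + block_sum h (fun v => m (s :: v)) w'
  else h [::] * m [::].

Fixpoint conv k h v : C :=
  k [::] * h v + (if v is s :: v' then conv (fun u => k (s :: u)) h v' else 0).

Lemma eq_block_sum h h' m m' w : h =1 h' -> m =1 m' ->
  block_sum h m w = block_sum h' m' w.
Proof.
elim: w h h' m m' => [|s w IH] h h' m m' hh mm /=; first by rewrite hh mm.
by rewrite mm; congr (_ * _ + _); apply: IH => // v; rewrite ?hh ?mm.
Qed.

Lemma block_sum_linearl a h h' m w :
  block_sum (fun v => a * h v + h' v) m w = a * block_sum h m w + block_sum h' m w.
Proof.
elim: w h h' m => [|s w IH] h h' m /=; first by ring.
rewrite (IH (fun v => h (s :: v)) (fun v => h' (s :: v))) IH; ring.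
Qed.

Lemma block_sum_linearr a h m m' w :
  block_sum h (fun v => a * m v + m' v) w = a * block_sum h m w + block_sum h m' w.
Proof.
elim: w h m m' => [|s w IH] h m m' /=; first by ring.
rewrite (IH h (fun v => m (s :: v)) (fun v => m' (s :: v))); ring.
Qed.

(** The letters that [k] picks in the first gap all precede those picked by [h]. Together they form
    one subword, cut into a prefix weighed by [k] and a suffix weighed by [h]. *)
Lemma block_sum_conv h k m w :
  block_sum h (block_sum k m) w = block_sum (conv k h) m w.
Proof.
elim: w h k m => [|s w IH] h k m /=; first by ring.
rewrite block_sum_linearr !IH.
rewrite (block_sum_linearl (k [::]) (fun v => h (s :: v))
  (fun v => conv (fun u => k (s :: u)) h v)); ring.
Qed.

Lemma block_sum0 h m w : h =1 (fun=> 0) -> block_sum h m w = 0.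
Proof.
elim: w h m => [|s w IH] h m h0 /=; first by rewrite h0 mul0r.
by rewrite !IH ?mulr0 ?addr0 // => v; rewrite h0.
Qed.

Lemma block_sum_delta m w :
  block_sum (fun v => if v is [::] then 1 else 0) m w = m w.
Proof.
elim: w m => [|s w IH] m /=; first by rewrite mul1r.
by rewrite IH block_sum0 // mulr0 add0r.
Qed.

(* The coefficient of [h w] in [block_sum h m w] is [m [::]], the other terms
   involving only shorter words. *)
Lemma eq_block_sum_short (h h' : seq T -> C) m (w : seq T) :
  (forall v, (size v < size w)%N -> h v = h' v) ->
  M [::] = 1 ->
  block_sum h m w - m [::] * h w = block_sum h' m w - m [::] * h' w.
Proof.
move=> + M1; elim: w h h' m => [|s w IH] h h' m hh /=; first by ring.
have := IH (fun v => h (s :: v)) (fun v => h' (s :: v)) M _.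
rewrite M1 !mul1r => /(_ (fun v vw => hh (s :: v) vw)) E1.
have E2 : block_sum h (fun v => m (s :: v)) w = block_sum h' (fun v => m (s :: v)) w.
  have := IH h h' (fun v => m (s :: v)) (fun v vw => hh v (leqW vw)).
  by rewrite hh /=; [move/addIr | rewrite ltnS].
rewrite E2; set x := block_sum h' _ w.
rewrite -[block_sum (fun v => h (s :: v)) M w](subrK (h (s :: w))) E1; ring.
Qed.

Lemma block_sum_inj (h h' : seq T -> C) : M [::] = 1 ->
  (forall w, block_sum h M w = block_sum h' M w) -> h =1 h'.
Proof.
move=> M1 E w; have [n] := ubnP (size w); elim: n w => // n IH w /ltnSE wn.
have := @eq_block_sum_short h h' M w; rewrite E M1 !mul1r.
by move=> /(_ (fun v vw => IH v (leq_trans vw wn)) erefl)/addrI/oppr_inj.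
Qed.

(* [block_sum_last] weighs the gap following the last chosen letter by [l]
   instead of [M]. *)
Fixpoint block_sum_last l h m ml w : C :=
  if w is s :: w' then
    m [::] * block_sum_last l (fun v => h (s :: v)) M l w'
    + block_sum_last l h (fun v => m (s :: v)) (fun v => ml (s :: v)) w'
  else h [::] * ml [::].

Lemma eq_block_sum_last l l' h m ml ml' w :
  (forall v, (size v <= size w)%N -> l v = l' v) ->
  (forall v, (size v <= size w)%N -> ml v = ml' v) ->
  block_sum_last l h m ml w = block_sum_last l' h m ml' w.
Proof.
elim: w h m ml ml' => [|s w IH] h m ml ml' ll mm /=; first by rewrite mm.
have ll' v : (size v <= size w)%N -> l v = l' v by move=> vw; apply/ll/leqW.
by congr (_ * _ + _); apply: IH => // v vw; apply: mm.
Qed.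

(** Once a letter is chosen [ml] is replaced by [l], so [ml] only matters for the empty subword. *)
Lemma block_sum_lastD l h m ml ml' w :
  block_sum_last l h m (fun v => ml v + ml' v) w =
  h [::] * ml w + block_sum_last l h m ml' w.
Proof.
elim: w m ml ml' => [|s w IH] m ml ml' /=; first by ring.
rewrite (IH _ (fun v => ml (s :: v)) (fun v => ml' (s :: v))); ring.
Qed.

(** Mirror image of [block_sum_conv]: here the last gap is expanded, and the letters picked by [k]
    form the suffix. *)
Lemma block_sum_last_conv h k m w :
  block_sum_last (block_sum k M) h m (block_sum k m) w = block_sum (conv h k) m w.
Proof.
elim: w h m => [|s w IH] h m /=; first by ring.
rewrite block_sum_lastD !IH.
rewrite (block_sum_linearl (h [::]) (fun v => k (s :: v))
  (fun v => conv (fun u => h (s :: u)) k v)); ring.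
Qed.

(** The final letter is either chosen, leaving an empty gap behind it, or it ends the last gap. *)
Lemma block_sum_rcons h m w a : M [::] = 1 ->
  block_sum h m (rcons w a) =
  block_sum (fun v => h (rcons v a)) m w +
  block_sum_last (fun v => M (rcons v a)) h m (fun v => m (rcons v a)) w.
Proof.
move=> M1; elim: w h m => [|s w IH] h m /=; first by rewrite M1; ring.
rewrite !IH; ring.
Qed.

Section Cumulants.
Variable K : seq T -> C.
Hypothesis M1 : M [::] = 1.
Hypothesis first_block : forall a w, M (a :: w) = block_sum (fun v => K (a :: v)) M w.

(** Expand by the block of the first letter s. Either a is in that block, or it ends the last gap,
    which by induction expands along the block of a. Regrouping by the two convolution lemmas gives
    the two cases of the expansion by the block of a: s belongs to it, or s starts its first gap. *)
Lemma last_block w a : M (rcons w a) = block_sum (fun v => K (rcons v a)) M w.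
Proof.
have [n] := ubnP (size w); elim: n w => // n IH [|s w] /= wn.
  by rewrite first_block /= M1.
rewrite first_block block_sum_rcons //; congr (_ + _).
  by rewrite M1 mul1r.
rewrite (@eq_block_sum_last _ (block_sum (fun v => K (rcons v a)) M) _ _ _
           (block_sum (fun v => K (rcons v a)) M)); last 2 first.
- by move=> v vw; apply: IH; apply: leq_ltn_trans vw _.
- by move=> v vw; apply: IH; apply: leq_ltn_trans vw _.
rewrite block_sum_last_conv -block_sum_conv.
by apply: eq_block_sum => // v; rewrite first_block.
Qed.

Lemma cumulant_cyclic a : (forall w, M (a :: w) = M (rcons w a)) ->
  forall v, K (a :: v) = K (rcons v a).
Proof.
move=> Ma; apply: (@block_sum_inj (fun v => K (a :: v)) (fun v => K (rcons v a))) => // w.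
by rewrite -first_block -last_block.
Qed.

(** Here [g] plays the role of the cumulants with ab as a single first letter. In the block
    expansion of M(a b w), b is in the block of a, or it starts the first gap; expanding that gap by
    the block of b yields the convolution. *)
Lemma cumulant_merge a b (g : seq T -> C) :
  (forall w, M (a :: b :: w) = block_sum g M w) ->
  forall v, K (a :: b :: v) = g v - conv (fun u => K (b :: u)) (fun u => K (a :: u)) v.
Proof.
move=> Mab v; apply/eqP; rewrite eq_sym subr_eq eq_sym; apply/eqP.
pose h v := 1 * K (a :: b :: v) + conv (fun u => K (b :: u)) (fun u => K (a :: u)) v.
rewrite -[K _]mul1r -[LHS]/(h v).
apply: block_sum_inj v => // w; rewrite block_sum_linearl mul1r -Mab first_block /=.
rewrite M1 mul1r; congr (_ + _).
by rewrite -block_sum_conv; apply: eq_block_sum => // v; rewrite first_block.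
Qed.

End Cumulants.

End BlockSums.

Lemma convE (T : Type) (C : comNzRingType) (k h : seq T -> C) v :
  conv k h v = \sum_(i < (size v).+1) k (take i v) * h (drop i v).
Proof.
elim: v k => [|s v IH] k /=; first by rewrite big_ord1 addr0.
by rewrite big_ord_recl /= IH.
Qed.

Lemma block_sum_map (T U : Type) (C : comNzRingType) (L : T -> U)
    (M h m : seq U -> C) (w : seq T) :
  block_sum M h m (map L w) =
  block_sum (fun v => M (map L v)) (fun v => h (map L v)) (fun v => m (map L v)) w.
Proof.
elim: w h m => [//|s w IH] h m /=.
by rewrite (IH (fun v => h (L s :: v))) (IH h (fun v => m (L s :: v))).
Qed.

Lemma conv0 (T : Type) (C : comNzRingType) (k h : seq T -> C) v :
  (forall u, (size u <= size v)%N -> k u = 0) -> conv k h v = 0.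
Proof.
move=> k0; rewrite convE big1 // => i _; rewrite k0 ?mul0r // size_take.
by case: ltnP => // /ltnW.
Qed.

(** * Free cumulants of words in X and its inverse *)

Section OneLetter.
Variables (C : comNzRingType) (K : seq unit -> C) (mom : nat -> C) (lam : C).
Let M (w : seq unit) : C := mom (size w).
Hypothesis mom0 : mom 0 = 1.
Hypothesis first_block : forall w, M (tt :: w) = block_sum M (fun v => K (tt :: v)) M w.

(** The subwords are sorted by the position i of their first letter. *)
Lemma block_sum_unroll h m (w : seq unit) :
  block_sum M h m w = h [::] * m w +
    \sum_(i < size w) m (take i w) * block_sum M (fun v => h (tt :: v)) M (drop i.+1 w).
Proof.
elim: w h m => [|[] w IH] h m; first by rewrite big_ord0 addr0.
by rewrite big_ord_recl /= drop0 [X in _ + X]IH addrCA.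
Qed.

(** With constant cumulants lam, the unrolled block sum is lam M(w) plus a sum whose inner block
    sums are shorter moments by induction; this is the quadratic recurrence, its term j = n being
    moved to the left. *)
Lemma cumulant_free_poisson :
  (forall n, mom n.+1 + (1 - lam) * mom n = \sum_(j < n.+1) mom j * mom (n - j)%N) ->
  forall n, K (nseq n.+1 tt) = lam.
Proof.
move=> mom_quad n.
apply: (@block_sum_inj _ _ M (fun v => K (tt :: v)) (fun=> lam)) (nseq n tt) => //.
move=> w; rewrite -first_block; move: w.
suff H l w : (size w < l)%N -> M (tt :: w) = block_sum M (fun=> lam) M w.
  by move=> w; apply: H (ltnSn _).
elim: l w => // l IH w /ltnSE wl; rewrite block_sum_unroll /M /=.
have := mom_quad (size w); rewrite big_ord_recr /= subnn mom0 mulr1 => /(canRL (addrK _)) ->.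
rewrite [in RHS](eq_bigr (fun i : 'I_(size w) => mom i * mom (size w - i)%N)); first by ring.
move=> i _; rewrite size_takel; last exact/ltnW/ltn_ord.
have iw := ltn_ord i.
rewrite -IH; last by rewrite size_drop; lia.
by rewrite /M /= size_drop; congr (_ * mom _); lia.
Qed.

(** The moment recurrence is the block sum of the cumulant recurrence, so [block_sum_inj] applies.
    [Kp] is 0 on the empty word because the second cumulant in each product has positive order. *)
Lemma cumulant_inverse_free_poisson :
  (forall n, (lam - 1) * mom n.+1 = mom n + \sum_(i < n) mom i.+1 * mom (n - i)%N) ->
  forall n, (lam - 1) * K (nseq n.+1 tt) =
    (n == 0)%:R + \sum_(i < n) K (nseq i.+1 tt) * K (nseq (n - i) tt).
Proof.
move=> mom_quad n.
pose k v := K (tt :: v); pose Kp v := if v is _ :: _ then K v else 0.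
pose delta (v : seq unit) : C := if v is [::] then 1 else 0.
have E : (fun v => (lam - 1) * k v + - delta v) =1 conv k Kp.
  apply: (block_sum_inj (M := M)) => // w.
  rewrite block_sum_linearl -first_block -block_sum_conv.
  have -> : block_sum M (fun v => - delta v) M w = - M w.
    have := block_sum_linearl M (-1) delta (fun=> 0) M w.
    have dM : block_sum M delta M w = M w by apply: block_sum_delta.
    rewrite (@block_sum0 _ _ M (fun=> 0)) // addr0 mulN1r dM => <-.
    by apply: eq_block_sum => // v; rewrite addr0 mulN1r.
  rewrite (@eq_block_sum _ _ M Kp Kp (block_sum M k M) (fun v => M (tt :: v))) //.
  rewrite block_sum_unroll mul0r add0r {1 2}/M /= mom_quad addrAC subrr add0r.
  apply: eq_bigr => i _; have iw := ltn_ord i.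
  rewrite /Kp -first_block /M /= size_takel ?size_drop; last exact/ltnW/ltn_ord.
  by congr (_ * mom _); lia.
have := E (nseq n tt); rewrite convE size_nseq big_ord_recr /=.
rewrite [drop n _]drop_oversize ?size_nseq //= mulr0 addr0.
move=> /(canRL (subrK _)) ->; rewrite addrC; congr (_ + _); first by case: (n).
apply: eq_bigr => i _; have iw := ltn_ord i; congr (_ * _).
  by rewrite /k take_nseq // ltnW.
by rewrite drop_nseq; case E' : (n - i)%N => [|l //]; lia.
Qed.

End OneLetter.

(* The letter [true] stands for X and [false] for its inverse. *)
Section TwoLetters.
Variables (C : comNzRingType) (M K : seq bool -> C) (lam : C).
Hypothesis M1 : M [::] = 1.
Hypothesis first_block : forall a w, M (a :: w) = block_sum M (fun v => K (a :: v)) M w.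
Hypothesis M_cyclic : forall a w, M (a :: w) = M (rcons w a).
Hypothesis M_inv : forall w, M (false :: true :: w) = M w.
Hypothesis KX : forall n, K (nseq n.+1 true) = lam.
Let kap n := K (nseq n false).
Hypothesis KY : forall n, (lam - 1) * kap n.+1 =
  (n == 0)%:R + \sum_(i < n) kap i.+1 * kap (n - i).

Lemma cumulant_YX v : K (false :: true :: v) =
  (if v is [::] then 1 else 0) - conv (fun u => K (true :: u)) (fun u => K (false :: u)) v.
Proof.
rewrite (@cumulant_merge _ _ M K M1 first_block false true
  (fun u => if u is [::] then 1 else 0)) // => w.
by rewrite M_inv block_sum_delta.
Qed.

Lemma cumulant_rot n w : K (rot n w) = K w.
Proof.
elim: n => [|n IH]; first by rewrite rot0.
case: (ltnP n (size w)) => [nw|wn]; last by rewrite rot_oversize // leqW.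
rewrite rotS // -IH; case: (rot n w) => [//|a u].
by rewrite rot1_cons (cumulant_cyclic M1 first_block).
Qed.

Definition not_both_true (a b : bool) := ~~ (a && b).
Local Notation e := not_both_true.

(** The value predicted by the theorem in a rotation invariant form: [cycle e w] says that no two
    letters X are cyclically adjacent. *)
Definition word_value w : C :=
  if cycle e w then (-1) ^+ count id w * kap (count negb w) else 0.

Lemma word_value_rot n w : word_value (rot n w) = word_value w.
Proof.
rewrite /word_value rot_cycle.
have /permP P : perm_eq (rot n w) w by rewrite perm_rot.
by rewrite !P.
Qed.

Lemma not_both_true_false a : e a false. Proof. by rewrite /e andbF. Qed.

Lemma cycle_false u : cycle e (false :: u) = path e false u.
Proof. by rewrite /= rcons_path not_both_true_false andbT. Qed.

Lemma cycle_true u : cycle e (true :: u) = path e true u && ~~ last true u.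
Proof. by rewrite /= rcons_path /e andbT. Qed.

Lemma path_false_cat u1 u2 : ~~ last false u1 ->
  path e false (u1 ++ u2) = path e false u1 && path e false u2.
Proof. by move=> /negbTE l; rewrite cat_path l. Qed.

(** A nonempty prefix that does not end in X is determined by its number of letters X^-1, and each
    positive number up to the total occurs once. The letter [b] preceding [v] decides whether the
    empty prefix counts. *)
Lemma sum_split_last (F : nat -> C) v b g :
  \sum_(i < (size v).+1) (if last b (take i v) then 0 else F (g + count negb (take i v))%N) =
  (if b then 0 else F g) + \sum_(j < count negb v) F (g + j.+1)%N.
Proof.
elim: v b g => [|s v IH] b g.
  by rewrite big_ord1 big_ord0 /= addn0 addr0.
rewrite big_ord_recl take0 /= addn0; congr (_ + _).
under eq_bigr do rewrite /= addnA.
rewrite IH; case: s => /=; first by rewrite addn0 add0r add0n.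
rewrite add1n big_ord_recl /= addn1; congr (_ + _).
by apply: eq_bigr => j _; rewrite /bump /= add1n addSnnS.
Qed.

Section Induction.
Variable N : nat.
Hypothesis IH : forall w : seq bool, (size w < N)%N -> false \in w -> K w = word_value w.

(** The first factor contains two adjacent X, so by induction it vanishes unless the prefix of [v]
    consists of X only, where it is lam. If [v] starts with X, the first term cancels the rest of
    the sum; otherwise only the empty prefix contributes. *)
Lemma conv_XX j v : (0 < j)%N -> (j.+2 + size v <= N)%N ->
  conv (fun u => K (true :: nseq j true ++ u)) (fun u => K (false :: u)) v =
  - lam * K [:: false, true & v].
Proof.
have KXX i : K (true :: nseq i true ++ [::]) = lam by rewrite cats0 (KX i).
(* Inserting an X between two cyclically adjacent letters X^-1 changes the sign. *)
have opp (u : seq bool) : (u == [::]) || (head true u == false) ->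
    ((size u).+2 < N)%N -> K (false :: u) = - K (false :: true :: u).
  move=> u0 uN; rewrite !IH ?inE //=; last exact: ltnW.
  rewrite /word_value !cycle_false /=.
  have -> : path e true u = path e false u by case: u u0 {uN} => [//|[] u].
  by case: ifP => _; rewrite ?oppr0 // add1n add0n exprS; ring.
elim: v j => [|[] v IHv] j j0 jN.
- rewrite /= KXX addr0 opp ?mulrN ?mulNr //=; simpl in jN; lia.
- rewrite /= KXX.
  have -> : conv (fun u => K (true :: nseq j true ++ true :: u)) (fun u => K (false :: u)) v =
      conv (fun u => K (true :: nseq j.+1 true ++ u)) (fun u => K (false :: u)) v.
    have sh u : nseq j true ++ true :: u = nseq j.+1 true ++ u by elim: (j) => //= l ->.
    by rewrite !convE; apply: eq_bigr => i _; rewrite sh.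
  rewrite IHv //; last by move: jN => /=; lia.
  rewrite [K (_ :: true :: true :: v)]IH ?inE //=; last by move: jN => /=; lia.
  by rewrite /word_value cycle_false /= mulr0 mulNr subrr.
- rewrite /= KXX conv0 => [|u uv].
    rewrite opp ?eqxx ?orbT //; first by rewrite addr0 mulrN mulNr.
    by move: jN => /=; lia.
  rewrite IH; last 2 first.
  - by rewrite /= size_cat size_nseq /=; move: jN => /=; lia.
  - by rewrite inE mem_cat inE eqxx !orbT.
  by rewrite /word_value cycle_true; case: j j0 jN.
Qed.

(** By [cumulant_YX] only shorter words remain. For empty [v], 1 - lam k_1 = - k_1; if [v] starts
    with X, [conv_XX] makes everything cancel; if it starts with X^-1, the convolution is the
    quadratic sum of [KY]. *)
Lemma cumulant_word_YX v : (size v).+2 = N ->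
  K [:: false, true & v] = word_value [:: false, true & v].
Proof.
case: v => [|[] v] vN; rewrite cumulant_YX /=.
- have KY0 : 1 = (lam - 1) * K [:: false] by rewrite [RHS](KY 0) big_ord0 addr0.
  rewrite addr0 (KX 0) [X in X - _]KY0 /word_value /= /kap /=; ring.
- rewrite (KX 0) /word_value cycle_false /=.
  have /= -> := @conv_XX 1 v isT; last by rewrite -vN.
  by rewrite mulNr subrr subr0.
have szv (u : seq bool) : (size u <= size v)%N -> ((size u).+2 < N)%N by rewrite -vN.
rewrite (KX 0) sub0r convE IH ?inE //=; last by rewrite -vN.
set n := count negb v; set p := count id v.
pose F j := kap j.+1 * kap (n.+1 - j)%N.
(* A prefix ending in X makes that X cyclically adjacent to the leading X, so its term is 0. *)
have -> : \sum_(i < (size v).+1) K [:: true, false & take i v] * K (false :: drop i v) =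
    (if path e false v then (-1) ^+ p.+1 else 0) * \sum_(i < (size v).+1)
      (if last false (take i v) then 0 else F (0 + count negb (take i v))%N).
  rewrite mulr_sumr; apply: eq_bigr => i _.
  have iv : (i <= size v)%N by rewrite -ltnS.
  have defv := cat_take_drop i v.
  have szt : (size (take i v) <= i)%N by rewrite size_take; case: ltnP.
  rewrite IH ?inE ?eqxx ?orbT //=; last by apply: szv; apply: leq_trans iv.
  rewrite IH ?inE ?eqxx //=; last by apply/ltnW/szv; rewrite size_drop leq_subr.
  rewrite /word_value cycle_true cycle_false /= [last false _]/=.
  have [l|l] := boolP (last false (take i v)); first by rewrite andbF mul0r mulr0.
  have pv : path e false v = path e false (take i v) && path e false (drop i v).
    by rewrite -path_false_cat // defv.
  have pE : p = (count id (take i v) + count id (drop i v))%N by rewrite -count_cat defv.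
  have nE : n = (count negb (take i v) + count negb (drop i v))%N by rewrite -count_cat defv.
  rewrite andbT pv.
  case: (path e false (take i v)) => /=; last by rewrite !mul0r.
  case: (path e false (drop i v)) => /=; last by rewrite mulr0 mul0r.
  rewrite pE /F nE !add1n !add0n.
  rewrite -[X in kap (X - _)]addnS addKn -[X in _ ^+ X * (_ * _)]addSn exprD; ring.
rewrite sum_split_last -/n.
have -> : F 0 + \sum_(j < n) F (0 + j.+1)%N = \sum_(j < n.+1) F j.
  by rewrite big_ord_recl.
have := KY n.+1; rewrite add0r => <-.
rewrite /word_value !cycle_false /= -/n -/p !add1n !add0n.
by case: (path e false v); rewrite ?mulr0 ?mul0r ?addr0 ?oppr0 // exprS; ring.
Qed.

End Induction.

Lemma rot_false_true u : true \in u ->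
  exists n v, rot n (false :: u) = [:: false, true & v].
Proof.
move=> Xu; have [a [v ->]] : exists a v, u = nseq a false ++ true :: v.
  elim: u Xu => [//|[] u IHu] Xu; first by exists 0%N, u.
  by have [a [v ->]] := IHu Xu; exists a.+1, v.
exists a, (v ++ nseq a false).
have -> : false :: nseq a false ++ true :: v = nseq a false ++ [:: false, true & v].
  by elim: a => //= a ->.
by rewrite -{1}(size_nseq a false) rot_size_cat.
Qed.

Lemma cumulant_word w : false \in w -> K w = word_value w.
Proof.
have [N] := ubnP (size w); elim: N w => // N IH w /ltnSE wN wY.
have [n [u rw]] : exists n u, rot n w = false :: u.
  exists (index false w), (drop (index false w).+1 w ++ take (index false w) w).
  by rewrite rot_index.
have wE : K w = K (false :: u) by rewrite -rw cumulant_rot.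
have vE : word_value w = word_value (false :: u) by rewrite -rw word_value_rot.
have su : size w = (size u).+1 by rewrite -(size_rot n) rw.
rewrite wE vE; have [uX|uX] := boolP (true \in u); last first.
  have -> : u = nseq (size u) false.
    apply/all_pred1P/allP => x xu /=; apply: contraNT uX.
    by rewrite eqbF_neg negbK => xT; rewrite -[true]xT.
  rewrite /word_value cycle_false.
  have -> : path e false (nseq (size u) false) by elim: (size u).
  rewrite /= add0n count_nseq mul0n expr0 mul1r count_nseq mul1n.
  by rewrite /kap add1n.
have [n' [v rv]] := rot_false_true uX.
rewrite -(cumulant_rot n') -(word_value_rot n') rv.
have sv : size u = (size v).+1 by have := congr1 size rv; rewrite size_rot /= => -[].
apply: (@cumulant_word_YX (size v).+2) => // w' w'N; apply: IH.
by apply: leq_trans w'N _; rewrite -sv -su.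
Qed.

End TwoLetters.

(** * The block of the first letter in a noncrossing partition *)

Section NoncrossingSums.
Variables (n : nat) (C : comNzRingType).
Implicit Types (f : {set 'I_n} -> C) (P Q : {set {set 'I_n}}).
Implicit Types (x y : 'I_n) (B D E G U V W : {set 'I_n}).

Definition crossing B B' := exists a b c d : 'I_n,
  [/\ a \in B, b \in B', c \in B & d \in B'] /\ [/\ a < b, b < c & c < d]%N.

Lemma noncrossingP P : reflect
  (forall B B', B \in P -> B' \in P -> B != B' -> ~ crossing B B') (noncrossing P).
Proof.
apply: (iffP idP) => [nc B B' BP B'P BB' [a [b [c [d [[aB bB cB dB] [ab bc cd]]]]]]|nc].
  move: nc => /'forall_implyP/(_ B BP)/'forall_implyP/(_ B' B'P)/implyP/(_ BB').
  move=> /'forall_implyP/(_ a aB)/'forall_implyP/(_ b bB).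
  by move=> /'forall_implyP/(_ c cB)/'forall_implyP/(_ d dB); rewrite ab bc cd.
apply/'forall_implyP => B BP; apply/'forall_implyP => B' B'P; apply/implyP => BB'.
apply/'forall_implyP => a aB; apply/'forall_implyP => b bB.
apply/'forall_implyP => c cB; apply/'forall_implyP => d dB.
by apply/negP => /and3P[ab bc cd]; apply: (nc B B') => //; exists a, b, c, d.
Qed.

Lemma noncrossingS P Q : P \subset Q -> noncrossing Q -> noncrossing P.
Proof.
move=> /subsetP PQ /noncrossingP nc; apply/noncrossingP => B B' BP B'P.
by apply: nc; apply: PQ.
Qed.

Definition nc_sum f E : C :=
  \sum_(P : {set {set 'I_n}} | partition P E && noncrossing P) \prod_(B in P) f B.

Definition nc_sum_around f V E : C :=
  \sum_(P : {set {set 'I_n}} | partition P E && noncrossing (V |: P)) \prod_(B in P) f B.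

Lemma nc_sum_first_block f x D : x \notin D ->
  nc_sum f (x |: D) =
  \sum_(V in powerset D) f (x |: V) * nc_sum_around f (x |: V) (D :\: V).
Proof.
move=> xD; rewrite /nc_sum.
rewrite (partition_big (fun P => pblock P x :\ x) (mem (powerset D))) /=; last first.
  move=> P /andP[partP _]; rewrite inE subDset; apply: (partitionS partP).
  by apply: pblock_mem; rewrite (cover_partition partP) setU11.
apply: eq_bigr => V; rewrite inE => VD; pose W := x |: V.
have xW : x \in W by rewrite setU11.
have WQ Q : partition Q (D :\: V) -> W \notin Q.
  move=> partQ; apply/negP => /(partitionS partQ)/subsetP/(_ x xW).
  by rewrite inE (negbTE xD) andbF.
rewrite (reindex_onto (fun Q => W |: Q) (fun P => P :\ W)) /=; last first.
  move=> P /andP[/andP[partP _] /eqP defV]; apply: setD1K.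
  have xP : x \in cover P by rewrite (cover_partition partP) setU11.
  by rewrite /W -defV setD1K ?mem_pblock // pblock_mem.
rewrite big_distrr /=; apply: eq_big => [Q|Q].
  have DV : (x |: D) :\: W = D :\: V.
    by apply/setP => y; rewrite !inE; case: eqVneq => [->|] //=; rewrite (negbTE xD) andbF.
  apply/idP/idP => [/andP[/andP[/andP[partP nc] /eqP defV] /eqP defQ]|/andP[partQ nc]].
    by rewrite nc andbT -DV -defQ; apply: partitionD1 => //; rewrite setU11.
  have partP : partition (W |: Q) (x |: D).
    have -> : x |: D = W :|: (D :\: V).
      apply/setP => y; rewrite !inE; case: (y == x) => //=.
      by case: (boolP (y \in V)) => [/(subsetP VD)->|].
    apply: partitionU1 => //; first by apply/set0Pn; exists x.
    rewrite -setI_eq0; apply/eqP/setP => y; rewrite !inE.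
    by case: eqVneq => [->|] /=; [rewrite (negbTE xD) andbF|case: (y \in V)].
  rewrite partP nc /= (def_pblock (partition_trivIset partP) (setU11 _ _) xW).
  rewrite /W setU1K ?eqxx /=; last by apply: contra xD => /(subsetP VD).
  by rewrite setU1K ?eqxx // -/W; apply: WQ.
case/andP=> /andP[/andP[partP _] _] /eqP defQ.
rewrite big_setU1 //=.
by rewrite -defQ setD11.
Qed.

Lemma nc_sum_around1 f x E : nc_sum_around f [set x] E = nc_sum f E.
Proof.
apply: eq_bigl => P; congr andb; apply/idP/idP.
  by apply: noncrossingS; apply: subsetUr.
move=> /noncrossingP nc; apply/noncrossingP => B B'.
move=> /setU1P[->|BP] /setU1P[->|B'P] BB'.
- by rewrite eqxx in BB'.
- move=> [a [b [c [d [[]]]]]]; rewrite !inE => /eqP-> _ /eqP-> _ [xb bx _].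
  by have := ltn_trans xb bx; rewrite ltnn.
- move=> [a [b [c [d [[]]]]]]; rewrite !inE => _ /eqP-> _ /eqP-> [_ xb bx].
  by have := ltn_trans xb bx; rewrite ltnn.
- exact: nc.
Qed.

Lemma nc_sum0 f : nc_sum f set0 = 1.
Proof.
rewrite /nc_sum (big_pred1 set0) ?big_set0 // => P.
rewrite partition_set0 andb_idr // => /eqP->.
by apply/noncrossingP => B B'; rewrite inE.
Qed.

Lemma crossingS B B' D D' :
  B \subset D -> B' \subset D' -> crossing B B' -> crossing D D'.
Proof.
move=> /subsetP BD /subsetP BD' [a [b [c [d [[aB bB cB dB] H]]]]].
by exists a, b, c, d; split=> //; split; [apply: BD|apply: BD'|apply: BD|apply: BD'].
Qed.

Section Split.
Variables (x y : 'I_n) (V G E : {set 'I_n}).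
Hypotheses (xy : (x < y)%N) (xG : forall g, g \in G -> (x < g)%N).
Hypotheses (Gy : forall g, g \in G -> (g < y)%N).
Hypotheses (yE : forall e, e \in E -> (y < e)%N) (yV : forall v, v \in V -> (y < v)%N).
Local Notation W := (x |: (y |: V)).
Local Notation W' := (y |: V).

Let GE B : B != set0 -> B \subset G -> B \subset E -> False.
Proof.
move=> /set0Pn[b bB] /subsetP/(_ b bB)/Gy gy /subsetP/(_ b bB)/yE ey.
by have := ltn_trans gy ey; rewrite ltnn.
Qed.

Let W_out B : B \subset G :|: E -> W != B.
Proof.
move=> /subsetP BGE; apply/eqP => WB; have /BGE : x \in B by rewrite -WB setU11.
by rewrite inE => /orP[/xG|/yE]; lia.
Qed.

Let W'_out B : B \subset E -> W' != B.
Proof.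
move=> /subsetP BE; apply/eqP => WB; have /BE/yE : y \in B by rewrite -WB setU11.
by rewrite ltnn.
Qed.

Let W_gap (z : 'I_n) : (x < z)%N -> (z < y)%N -> z \in W -> False.
Proof.
move=> xz zy; rewrite !inE => /or3P[/eqP zx|/eqP zy'|/yV yz].
- by rewrite zx ltnn in xz.
- by rewrite zy' ltnn in zy.
- by have := ltn_trans zy yz; rewrite ltnn.
Qed.

Let W_tail (z : 'I_n) : (y < z)%N -> z \in W -> z \in W'.
Proof.
by move=> yz /setU1P[zx|//]; move: (ltn_trans xy yz); rewrite zx ltnn.
Qed.

Let block_split Q B : partition Q (G :|: E) -> noncrossing (W |: Q) -> B \in Q ->
  (B \subset G) || (B \subset E).
Proof.
move=> partQ /noncrossingP nc BQ; have /subsetP BGE := partitionS partQ BQ.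
apply: contraT; rewrite negb_or.
move=> /andP[/fintype.subsetPn[e eB eG] /fintype.subsetPn[g gB gE]].
have /setUP[|eE] := BGE e eB; first by rewrite (negbTE eG).
have /setUP[gG|] := BGE g gB; last by rewrite (negbTE gE).
have BW : W != B by apply: W_out; apply/subsetP.
exfalso; apply: (nc W B) => //; rewrite ?setU11 ?setU1r //.
exists x, g, y, e; split; split; rewrite ?inE ?eqxx ?orbT //;
  by [apply: xG|apply: Gy|apply: yE].
Qed.

Let partition_side Q D : partition Q (G :|: E) -> D \subset G :|: E ->
  (forall B z, B \in Q -> z \in B -> z \in D -> B \subset D) -> partition (Q ::&: D) D.
Proof.
move=> partQ /subsetP DGE QD; have trivQ := partition_trivIset partQ; apply/and3P; split.
- rewrite eqEsubset; apply/andP; split.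
    exact: subset_trans (cover_setI _ _) (subsetIr _ _).
  apply/subsetP => z zD; have zQ : z \in cover Q by rewrite (cover_partition partQ) DGE.
  apply/bigcupP; exists (pblock Q z); last by rewrite mem_pblock.
  by rewrite inE pblock_mem //= (QD _ z) ?pblock_mem ?mem_pblock.
- exact: trivIsetI.
- by rewrite inE (partition0 partQ).
Qed.

Let disjGE : [disjoint G & E].
Proof.
rewrite -setI_eq0; apply/eqP/setP => z; rewrite !inE.
by apply/negP => /andP[/Gy zy /yE]; lia.
Qed.

(** A block containing g in [G] and e in [E] would cross [W], as x < g < y < e. So each block lies
    in [G], where [W] has no point and imposes nothing, or in [E], where only the points of [W] from
    y on matter. *)
Lemma nc_sum_around_split f :
  nc_sum_around f W (G :|: E) = nc_sum f G * nc_sum_around f W' E.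
Proof.
rewrite /nc_sum /nc_sum_around big_distrlr /= pair_big /=.
rewrite (reindex_onto (fun p => p.1 :|: p.2) (fun Q => (Q ::&: G, Q ::&: E))) /=; last first.
  move=> Q /andP[partQ nc]; apply/setP => B; rewrite !inE -andb_orr.
  by apply: andb_idr; apply: block_split.
apply: eq_big => [[Q1 Q2]|[Q1 Q2]] /=.
  apply/idP/idP => [/andP[/andP[partQ nc] /eqP[def1 def2]]|].
    set Q := Q1 :|: Q2 in partQ nc def1 def2; rewrite -def1 -def2.
    have bs := block_split partQ nc.
    apply/andP; split; apply/andP; split.
    - apply: (partition_side partQ) => [|B z BQ zB zG]; first exact: subsetUl.
      case/orP: (bs _ BQ) => // /subsetP/(_ z zB)/yE yz.
      by have := ltn_trans yz (Gy zG); rewrite ltnn.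
    - by apply: noncrossingS nc; apply/subsetP => B; rewrite !inE => /andP[->]; rewrite orbT.
    - apply: (partition_side partQ) => [|B z BQ zB zE]; first exact: subsetUr.
      case/orP: (bs _ BQ) => // /subsetP/(_ z zB)/Gy zy.
      by have := ltn_trans zy (yE zE); rewrite ltnn.
    - have WW : W' \subset W by apply: subsetUr.
      move: nc => /noncrossingP nc; apply/noncrossingP => B B'.
      have QW B0 : B0 \in Q -> W != B0 by move=> /(partitionS partQ); apply: W_out.
      have QE B0 : B0 \in Q ::&: E -> B0 \in W |: Q by rewrite !inE => /andP[->]; rewrite orbT.
      have QE' B0 : B0 \in Q ::&: E -> W != B0 by rewrite inE => /andP[/QW].
      move=> /setU1P[->|BQ] /setU1P[->|BQ']; rewrite ?eqxx // => BB'.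
      + move=> /(crossingS WW (subxx _)).
        by apply: nc; rewrite ?setU11 ?QE' ?QE.
      + move=> /(crossingS (subxx _) WW).
        by apply: nc; rewrite ?setU11 1?eq_sym ?QE' ?QE.
      + by apply: nc; rewrite ?QE.
  move=> /andP[/andP[part1 nc1] /andP[part2 nc2]].
  have sub1 B : B \in Q1 -> B \subset G by apply: partitionS.
  have sub2 B : B \in Q2 -> B \subset E by apply: partitionS.
  have partQ : partition (Q1 :|: Q2) (G :|: E).
    apply/and3P; split.
    - rewrite /cover bigcup_setU /= -!/(cover _).
      by rewrite (cover_partition part1) (cover_partition part2).
    - apply: trivIsetU; rewrite ?(partition_trivIset part1) ?(partition_trivIset part2) //.
      by rewrite (cover_partition part1) (cover_partition part2).
    - by rewrite inE (partition0 part1) (partition0 part2).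
  rewrite partQ /=; apply/andP; split; last first.
    rewrite xpair_eqE; apply/andP; split; apply/eqP/setP => B; rewrite !inE.
      apply/andP/idP => [[/orP[//|B2] BG]|B1]; last by rewrite B1 sub1.
      by have := GE (partition_neq0 part2 B2) BG (sub2 _ B2).
    apply/andP/idP => [[/orP[B1|//] BE]|B2]; last by rewrite B2 orbT sub2.
    by have := GE (partition_neq0 part1 B1) (sub1 _ B1) BE.
  apply/noncrossingP => B B' /setU1P[->|BQ] /setU1P[->|BQ']; rewrite ?eqxx //.
  - move=> _ [a [b [c [d [[aW bB cW dB] [ab bc cd]]]]]]; move: BQ' => /setUP[B1|B2].
      have /subsetP BG := sub1 _ B1; have xb := xG (BG _ bB); have dy := Gy (BG _ dB).
      exact: W_gap (ltn_trans xb bc) (ltn_trans cd dy) cW.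
    have /subsetP BE := sub2 _ B2; have yb := yE (BE _ bB).
    move: nc2 => /noncrossingP/(_ W' B'); apply.
    + exact: setU11.
    + by rewrite setU1r.
    + by apply: W'_out; apply: sub2.
    + exists y, b, c, d; split; split=> //; rewrite ?setU11 //.
      exact: W_tail (ltn_trans yb bc) cW.
  - move=> _ [a [b [c [d [[aB bW cB dW] [ab bc cd]]]]]]; move: BQ => /setUP[B1|B2].
      have /subsetP BG := sub1 _ B1; have xa := xG (BG _ aB); have cy := Gy (BG _ cB).
      exact: W_gap (ltn_trans xa ab) (ltn_trans bc cy) bW.
    have /subsetP BE := sub2 _ B2; have ya := yE (BE _ aB).
    move: nc2 => /noncrossingP/(_ B W'); apply.
    + by rewrite setU1r.
    + exact: setU11.
    + by rewrite eq_sym; apply: W'_out; apply: sub2.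
    + exists a, b, c, d; split; split=> //.
        exact: W_tail (ltn_trans ya ab) bW.
      exact: W_tail (ltn_trans (ltn_trans (ltn_trans ya ab) bc) cd) dW.
  - move: BQ BQ' => /setUP[B1|B2] /setUP[B1'|B2'] BB'.
    + by move: nc1 => /noncrossingP; apply.
    + move=> [a [b [c [d [[aB bB cB dB] [ab bc cd]]]]]].
      have /subsetP/(_ _ cB)/Gy cy := sub1 _ B1; have /subsetP/(_ _ bB)/yE yb := sub2 _ B2'.
      by have := ltn_trans (ltn_trans yb bc) cy; rewrite ltnn.
    + move=> [a [b [c [d [[aB bB cB dB] [ab bc cd]]]]]].
      have /subsetP/(_ _ aB)/yE ya := sub2 _ B2; have /subsetP/(_ _ bB)/Gy yb := sub1 _ B1'.
      by have := ltn_trans (ltn_trans ya ab) yb; rewrite ltnn.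
    + by move: nc2 => /noncrossingP; apply; rewrite ?setU1r.
case/andP=> /andP[partQ _] /eqP[defQ1 defQ2].
rewrite (eq_bigl [predU Q1 & Q2]) => [|B]; last by rewrite !inE.
rewrite bigU //= disjoint_subset; apply/subsetP => B B1; rewrite inE; apply/negP => B2.
have BQ : B \in Q1 :|: Q2 by rewrite inE B1.
move: B1 B2; rewrite -defQ1 -defQ2 !inE => /andP[_ BG] /andP[_ BE].
exact: GE (partition_neq0 partQ BQ) BG BE.
Qed.

End Split.

Lemma big_powersetU1 y U (F : {set 'I_n} -> C) : y \notin U ->
  \sum_(V in powerset (y |: U)) F V = \sum_(V in powerset U) (F V + F (y |: V)).
Proof.
move=> yU; rewrite (bigID (fun V => y \notin V)) /= big_split /=; congr (_ + _).
  apply: eq_bigl => V; rewrite !inE; apply/andP/idP => [[/subsetP VU yV]|VU].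
    apply/subsetP => v vV; have /setU1P[vy|//] := VU v vV.
    by rewrite -vy vV in yV.
  by rewrite (subset_trans VU) ?subsetUr //; split=> //; apply: contra yU; apply: (subsetP VU).
rewrite (reindex_onto (fun V => y |: V) (fun V => V :\ y)) /= => [|V /andP[_ /negPn yV]].
  apply: eq_bigl => V; rewrite !inE eqxx /= andbT; apply/andP/idP => [[VU /eqP <-]|VU].
    by rewrite subDset; apply: subset_trans VU _.
  have yV : y \notin V by apply: contra yU; apply: (subsetP VU).
  by rewrite setU1K ?eqxx // setUS.
by rewrite setD1K.
Qed.

(** Set version of [block_sum]: x is the last point put into the block, [G] the part of the current
    gap already read, [U] the points still to be read, and [h V] the weight of the block when it
    continues by [V]. *)
Definition nc_block_sum f (h : {set 'I_n} -> C) x G U :=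
  \sum_(V in powerset U) h V * nc_sum_around f (x |: V) ((G :|: U) :\: V).

Lemma nc_block_sum0 f h x G : nc_block_sum f h x G set0 = h set0 * nc_sum f G.
Proof.
by rewrite /nc_block_sum powerset0 big_set1 !setU0 setD0 nc_sum_around1.
Qed.

(** The recursion of [block_sum]: the next point y either joins the block, which closes the gap [G]
    and splits off its factor, or extends the gap. *)
Lemma nc_block_sum_step f h x y G U : (x < y)%N ->
  (forall g, g \in G -> (x < g < y)%N) -> (forall u, u \in U -> (y < u)%N) ->
  nc_block_sum f h x G (y |: U) =
  nc_sum f G * nc_block_sum f (fun V => h (y |: V)) y set0 U +
  nc_block_sum f h x (y |: G) U.
Proof.
move=> xy xGy yU; have yNU : y \notin U by apply/negP => /yU; rewrite ltnn.
have yNG : y \notin G by apply/negP => /xGy; rewrite ltnn andbF.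
rewrite /nc_block_sum big_powersetU1 // big_split /= addrC; congr (_ + _); last first.
  by apply: eq_bigr => V _; rewrite setUCA setUA.
rewrite big_distrr; apply: eq_bigr => V; rewrite inE => VU /=.
rewrite mulrCA; congr (_ * _).
have -> : (G :|: (y |: U)) :\: (y |: V) = G :|: (U :\: V).
  apply/setP => z; rewrite !inE; case: eqVneq => [->|_] /=.
    by rewrite (negbTE yNU) (negbTE yNG) andbF.
  case: (boolP (z \in V)) => //= zV; apply/esym/negP; rewrite orbF => /xGy.
  by have := yU _ (subsetP VU _ zV); lia.
rewrite set0U; apply: nc_sum_around_split => //.
- by move=> g /xGy/andP[].
- by move=> g /xGy/andP[].
- by move=> e /setDP[/yU].
- by move=> v /(subsetP VU)/yU.
Qed.

End NoncrossingSums.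

(** * Increasing enumerations and transport of noncrossing partitions *)

Lemma enum_sorted_ltn n (B : {set 'I_n}) : sorted (relpre val ltn) (enum B).
Proof.
rewrite {1}/enum_mem -enumT; apply: sorted_filter; first by move=> x y z; apply: ltn_trans.
by rewrite -sorted_map val_enum_ord iota_ltn_sorted.
Qed.

Lemma sorted_ltn_enum n (B : {set 'I_n}) (s : seq 'I_n) :
  sorted (relpre val ltn) s -> s =i B -> s = enum B.
Proof.
move=> ss sB; apply: (@irr_sorted_eq _ (relpre val ltn)) => //.
- by move=> x y z; apply: ltn_trans.
- by move=> x; apply: ltnn.
- exact: enum_sorted_ltn.
- by move=> x; rewrite mem_enum sB.
Qed.

Lemma enum_setU1_min n (y : 'I_n) (V : {set 'I_n}) :
  (forall v, v \in V -> (y < v)%N) -> enum (y |: V) = y :: enum V.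
Proof.
move=> yV; apply/esym/sorted_ltn_enum; last by move=> z; rewrite !inE mem_enum.
rewrite /= path_min_sorted ?enum_sorted_ltn //.
by apply/allP => v; rewrite mem_enum; apply: yV.
Qed.

Lemma enum_setU1_max n (y : 'I_n) (V : {set 'I_n}) :
  (forall v, v \in V -> (v < y)%N) -> enum (y |: V) = rcons (enum V) y.
Proof.
move=> Vy; apply/esym/sorted_ltn_enum; last by move=> z; rewrite !inE mem_rcons inE mem_enum.
rewrite -cats1; have := enum_sorted_ltn V; case E: (enum V) => [//|v s] /= vs.
rewrite cat_path vs /= andbT; apply: Vy.
by rewrite -mem_enum E mem_last.
Qed.

Section Increasing.
Variables (m n : nat) (g : 'I_m -> 'I_n).
Hypothesis g_incr : forall i j : 'I_m, (i < j)%N -> (g i < g j)%N.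

Lemma incr_mono (i j : 'I_m) : (g i < g j)%N = (i < j)%N.
Proof.
apply/idP/idP => [gij|]; last exact: g_incr.
case: (ltngtP i j) => // [/g_incr|/val_inj ij]; first by lia.
by rewrite ij ltnn in gij.
Qed.

Lemma incr_inj : injective g.
Proof.
move=> i j gij; apply/val_inj/eqP; case: (ltngtP i j) => // /g_incr.
  by rewrite gij ltnn.
by rewrite gij ltnn.
Qed.

Lemma enum_imset_incr (B : {set 'I_m}) : enum (g @: B) = map g (enum B).
Proof.
apply/esym/sorted_ltn_enum.
  rewrite sorted_map; apply: sub_sorted (enum_sorted_ltn B) => i j.
  exact: g_incr.
move=> z; apply/mapP/imsetP => [[j]|[j jB ->]]; first by rewrite mem_enum; exists j.
by exists j; rewrite ?mem_enum.
Qed.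

Lemma noncrossing_imset (P : {set {set 'I_m}}) :
  noncrossing [set g @: (B : {set 'I_m}) | B in P] = noncrossing P.
Proof.
apply/noncrossingP/noncrossingP => nc B B'.
  move=> BP B'P BB' [a [b [c [d [[aB bB cB dB] [ab bc cd]]]]]].
  apply: (nc (g @: B) (g @: B')); rewrite ?imset_f // ?(inj_eq (imset_inj incr_inj)) //.
  by exists (g a), (g b), (g c), (g d); rewrite !imset_f // !g_incr.
move=> /imsetP[D DP ->] /imsetP[D' DP' ->] DD'.
move=> [a' [b' [c' [d' [[aD' bD' cD' dD']]]]]].
move: aD' bD' cD' dD' => /imsetP[a aD ->] /imsetP[b bD ->] /imsetP[c cD ->] /imsetP[d dD ->].
rewrite !incr_mono => abcd; apply: (nc D D') => //; first by apply: contraNneq DD' => ->.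
by exists a, b, c, d.
Qed.

Lemma nc_sum_imset (C : comNzRingType) (f : {set 'I_n} -> C) :
  nc_sum f (g @: setT) = \sum_(P in NC m) \prod_(B in P) f (g @: B).
Proof.
rewrite /nc_sum (reindex_onto
  (fun P : {set {set 'I_m}} => [set g @: (B : {set 'I_m}) | B in P])
  (fun Q : {set {set 'I_n}} => [set g @^-1: (B : {set 'I_n}) | B in Q])) /=; last first.
  move=> Q /andP[partQ _]; rewrite -imset_comp -[RHS]imset_id; apply: eq_in_imset => B BQ /=.
  apply/setP => z; apply/imsetP/idP => [[j]|zB]; first by rewrite inE => gB ->.
  have /imsetP[i _ zi] := subsetP (partitionS partQ BQ) z zB.
  by exists i; rewrite // inE -zi.
apply: eq_big => [P|P _].
  rewrite inE imset_partition; last exact: incr_inj.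
  rewrite noncrossing_imset andb_idr // => _; apply/eqP.
  rewrite -imset_comp -[RHS]imset_id; apply: eq_in_imset => B BP /=.
  by apply/setP => i; rewrite inE mem_imset //; apply: incr_inj.
by rewrite big_imset //= => B B' _ _; apply: imset_inj; apply: incr_inj.
Qed.

End Increasing.

(** * First-block expansion of the moments of an algebra element word *)

Section FirstBlock.
Variables (R : realType) (A : cstarAlgType R) (phi : state A).
Local Notation K := (free_cumulant phi).
Definition word_moment (w : seq A) := phi (\prod_(x <- w) x).
Local Notation M := word_moment.
Local Notation restrict := Defs.restrict.

Lemma word_moment_nil : M [::] = 1.
Proof. by rewrite /M big_nil state1. Qed.

(** The moment-cumulant formula of the subword on [D], transported along the increasing enumeration
    [g] of [D]. *)
Lemma nc_sum_cumulant (s : seq A) (D : {set 'I_(size s)}) :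
  nc_sum (fun B => K (restrict s B)) D = M (restrict s D).
Proof.
have [->|/set0Pn[x xD]] := eqVneq D set0.
  by rewrite nc_sum0 /restrict enum_set0 word_moment_nil.
rewrite /M moment_cumulant; last by rewrite size_restrict card_gt0; apply/set0Pn; exists x.
pose g (k : 'I_(size (restrict s D))) := nth x (enum D) k.
have szD : size (restrict s D) = size (enum D) by rewrite size_map.
have g_incr (i j : 'I_(size (restrict s D))) : (i < j)%N -> (g i < g j)%N.
  move=> ij; have := enum_sorted_ltn D; move/(sorted_ltn_nth _ x).
  by apply; rewrite // ?inE -?szD //; move=> ? ? ?; apply: ltn_trans.
have gD : D = g @: setT.
  apply/setP => z; apply/idP/imsetP => [zD|[k _ ->]]; last first.
    by rewrite -mem_enum mem_nth // -szD.
  have zk : (index z (enum D) < size (restrict s D))%N by rewrite szD index_mem mem_enum.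
  by exists (Ordinal zk); rewrite // /g /= nth_index ?mem_enum.
rewrite {1}gD nc_sum_imset //; apply: eq_bigr => P _; apply: eq_bigr => B _.
rewrite /restrict enum_imset_incr // -map_comp; congr (K _); apply: eq_map => k /=.
by rewrite [RHS](tnth_nth 0) /= (nth_map x) // -szD.
Qed.

Lemma restrict_setU1_min (s : seq A) (y : 'I_(size s)) (V : {set 'I_(size s)}) :
  (forall v, v \in V -> (y < v)%N) ->
  restrict s (y |: V) = tnth (in_tuple s) y :: restrict s V.
Proof. by move=> yV; rewrite /restrict enum_setU1_min. Qed.

Lemma restrict_setU1_max (s : seq A) (y : 'I_(size s)) (V : {set 'I_(size s)}) :
  (forall v, v \in V -> (v < y)%N) ->
  restrict s (y |: V) = rcons (restrict s V) (tnth (in_tuple s) y).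
Proof. by move=> yV; rewrite /restrict enum_setU1_max // map_rcons. Qed.

(** Both sides obey the same recursion on the unread positions k, k+1, ...; the positions strictly
    between x and k are the part of the gap already read. *)
Lemma nc_block_sum_list (s : seq A) (h : seq A -> R[i]) (x : 'I_(size s)) k :
  (x < k)%N -> (k <= size s)%N ->
  nc_block_sum (fun B => K (restrict s B)) (fun V => h (restrict s V)) x
    [set j : 'I_(size s) | (x < j < k)%N] [set j : 'I_(size s) | (k <= j)%N] =
  block_sum M h
    (fun v => M (restrict s [set j : 'I_(size s) | (x < j < k)%N] ++ v)) (drop k s).
Proof.
move: {2}(size s - k)%N (erefl (size s - k)%N) => r.
elim: r h x k => [|r IH] h x k kr xk ks.
  have -> : [set j : 'I_(size s) | (k <= j)%N] = set0.
    by apply/setP => j; rewrite !inE; have := ltn_ord j; lia.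
  rewrite nc_block_sum0 drop_oversize /=; last by lia.
  by rewrite /restrict enum_set0 cats0 -nc_sum_cumulant.
have ks' : (k < size s)%N by lia.
pose y := Ordinal ks'; set G := [set j : 'I_(size s) | (x < j < k)%N].
have defU : [set j : 'I_(size s) | (k <= j)%N] = y |: [set j : 'I_(size s) | (k.+1 <= j)%N].
  by apply/setP => j; rewrite !inE -val_eqE /=; lia.
rewrite defU nc_block_sum_step //; last 2 first.
- by move=> g; rewrite inE.
- by move=> u; rewrite inE.
have defG : y |: G = [set j : 'I_(size s) | (x < j < k.+1)%N].
  by apply/setP => j; rewrite !inE -val_eqE /=; lia.
rewrite (drop_nth 0 ks') /=; congr (_ * _ + _).
- by rewrite cats0 nc_sum_cumulant.
- have := IH (fun v => h (s`_k :: v)) y k.+1; rewrite ltnSn => /(_ _ isT ks').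
  have -> : [set j : 'I_(size s) | (y < j < k.+1)%N] = set0.
    by apply/setP => j; rewrite !inE /=; lia.
  rewrite {3}/restrict enum_set0 /= => <-; last by lia.
  apply: eq_bigr => V; rewrite inE => /subsetP VU; congr (h _ * _).
  rewrite restrict_setU1_min ?(tnth_nth 0) // => v /VU; by rewrite inE.
- rewrite defG IH //; [|by lia..]; apply: eq_block_sum => // v.
  rewrite -defG restrict_setU1_max ?cat_rcons ?(tnth_nth 0) //.
  by move=> j; rewrite inE => /andP[].
Qed.

Lemma moment_first_block (a : A) (w : seq A) :
  M (a :: w) = block_sum M (fun v => K (a :: v)) M w.
Proof.
set s := a :: w; pose x : 'I_(size s) := ord0.
have sT : restrict s setT = s by rewrite restrictT.
rewrite -{1}sT -nc_sum_cumulant.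
have -> : [set: 'I_(size s)] = x |: [set j : 'I_(size s) | (1 <= j)%N].
  by apply/setP => j; rewrite !inE -val_eqE /=; case: (val j).
rewrite nc_sum_first_block ?inE //.
have := @nc_block_sum_list s (fun v => K (a :: v)) x 1 isT isT.
have -> : [set j : 'I_(size s) | (x < j < 1)%N] = set0.
  by apply/setP => j; rewrite !inE /=; lia.
rewrite {3}/restrict enum_set0 /= drop0 => <-.
apply: eq_bigr => V; rewrite inE => /subsetP VU; rewrite set0U; congr (K _ * _).
by rewrite restrict_setU1_min // => v /VU; rewrite inE.
Qed.

End FirstBlock.

(* [all_classical] shadows the names of [finset], hence the late import. *)
From mathcomp Require Import all_classical all_reals all_analysis.
From mathcomp Require Import measurable_realfun.
Import numFieldNormedType.Exports.

(** * Quadratic recurrences *)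

Section Jacobi.
Variable R : realFieldType.
Implicit Types (d q : R) (u v : nat -> R).

Definition jacobi d q u (k : nat) : R :=
  d * u k + q * u k.+1 + (if k is k'.+1 then q * u k' else 0).

(* The entries (k, 0) of the n-th power of the tridiagonal matrix with d on the
   diagonal and q next to it. *)
Definition jacobi_moment d q (n : nat) : nat -> R :=
  iter n (jacobi d q) (fun k => (k == 0)%:R).

Local Notation jm := jacobi_moment.

Lemma jacobi_momentS d q n k :
  jm d q n.+1 k = d * jm d q n k + q * jm d q n k.+1
    + (if k is k'.+1 then q * jm d q n k' else 0).
Proof. by []. Qed.

(* A walk from 0 to k.+1 is cut at its last step from k to k.+1. *)
Lemma jacobi_moment_last_passage d q n k :
  jm d q n.+1 k.+1 = q * \sum_(j < n.+1) jm d q (n - j) k * jm d q j 0.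
Proof.
elim: n k => [|n IH] k.
  by rewrite big_ord1 jacobi_momentS /jacobi_moment /= !mulr0 !add0r mulr1.
rewrite jacobi_momentS !IH [in RHS]big_ord_recr /= subnn.
have -> : \sum_(j < n.+1) jm d q (n.+1 - j) k * jm d q j 0 =
    \sum_(j < n.+1) (d * (jm d q (n - j) k * jm d q j 0)
      + q * (jm d q (n - j) k.+1 * jm d q j 0)
      + (if k is k'.+1 then q * (jm d q (n - j) k' * jm d q j 0) else 0)).
  apply: eq_bigr => j _; rewrite subSn ?jacobi_momentS; last by rewrite -ltnS.
  by case: k => [|k]; ring.
rewrite !big_split /= -!mulr_sumr; case: k => [|k].
  by rewrite big1_eq /=; ring.
by rewrite -mulr_sumr -[jacobi d q (jm d q n) k.+1]/(jm d q n.+1 k.+1) IH /=; ring.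
Qed.

Lemma jacobi_moment_quadratic d q n :
  jm d q n.+2 0 = d * jm d q n.+1 0 +
    q ^+ 2 * \sum_(j < n.+1) jm d q (n - j) 0 * jm d q j 0.
Proof. by rewrite jacobi_momentS jacobi_moment_last_passage; ring. Qed.

Lemma jacobi_moment_bound q n k : 0 <= q -> `|jm 0 q n k| <= (2 * q) ^+ n.
Proof.
move=> q0; elim: n k => [|n IH] k.
  by rewrite /jacobi_moment /= expr0; case: (k == 0); rewrite ?normr1 ?normr0.
rewrite jacobi_momentS mul0r add0r exprS -mulrA mulr_natl mulr2n.
apply: le_trans (ler_normD _ _) _; apply: lerD.
  by rewrite normrM ger0_norm // ler_wpM2l.
case: k => [|k]; last by rewrite normrM ger0_norm // ler_wpM2l.
by rewrite normr0 !mulr_ge0 // exprn_ge0 // mulr_ge0.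
Qed.

Lemma iter_jacobi_linear d q (c : R) u v j k :
  iter j (jacobi d q) (fun k => c * u k + v k) k =
  c * iter j (jacobi d q) u k + iter j (jacobi d q) v k.
Proof.
elim: j k => [//|j IH] k /=; rewrite /jacobi !IH.
by case: k => [|k]; rewrite ?IH; ring.
Qed.

Lemma eq_iter_jacobi d q u v j k : u =1 v ->
  iter j (jacobi d q) u k = iter j (jacobi d q) v k.
Proof.
by move=> uv; elim: j k => [//|j IH] k /=; rewrite /jacobi !IH; case: k => [|k]; rewrite ?IH.
Qed.

(** The tridiagonal matrix with diagonal 0 is the one with diagonal d minus d times the identity, so
    lowering by d in the argument of [f] replaces a factor of one by a factor of the other. *)
Lemma jacobi_moment_shift d q (lam : R) (f : nat -> nat -> R) :
  (forall j, f j 0 = lam * jm d q j 0) ->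
  (forall j a, f j a.+1 = f j.+1 a - d * f j a) ->
  forall j a, f j a = lam * iter j (jacobi d q) (jm 0 q a) 0.
Proof.
move=> f0 fS j a; elim: a j => [|a IH] j; first by rewrite f0.
rewrite fS !IH iterSr.
have -> : iter j (jacobi d q) (jacobi d q (jm 0 q a)) 0 =
    iter j (jacobi d q) (fun k => d * jm 0 q a k + jm 0 q a.+1 k) 0.
  by apply: eq_iter_jacobi => k; rewrite jacobi_momentS /jacobi; ring.
rewrite iter_jacobi_linear; ring.
Qed.

End Jacobi.

(** * Transfer of the quadratic recurrence to negative moments *)

Section NegativeMoments.
Variables (R : realType) (lam d q : R) (e : nat -> nat -> R).
Hypotheses (q0 : 0 < q) (q2 : q ^+ 2 = lam) (dE : d = 1 + lam) (qd : 2 * q < d).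
(** The moments of the centered semicircle law of variance lam. In the application [e k a] is the
    real part of phi(X^-k S^a) with S = X - d. *)
Let sg a := jacobi_moment 0 q a 0.
Hypothesis e00 : e 0 0 = 1.
Hypothesis e0S : forall a, e 0 a.+1 + d * e 0 a = lam * sg a.
Hypothesis eS : forall k a, e k.+1 a.+1 + d * e k.+1 a = e k a.
Hypothesis e_bound : forall k, exists2 C, 0 <= C & forall a, `|e k a| <= C * (2 * q) ^+ a.

Lemma semicircle_quadratic a : sg a.+1 = lam * \sum_(i < a) sg (a.-1 - i) * sg i.
Proof.
case: a => [|a]; last by rewrite /sg jacobi_moment_quadratic q2 mul0r add0r.
by rewrite big_ord0 mulr0 /sg /jacobi_moment /= /jacobi /= !mulr0 mul0r !addr0.
Qed.

Lemma sum_shift (u v : nat -> R) a :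
  \sum_(i < a.+1) u i * v (a - i)%N + d * \sum_(i < a) u i * v (a.-1 - i)%N =
  u 0 * v a + \sum_(i < a) (u i.+1 + d * u i) * v (a.-1 - i)%N.
Proof.
rewrite big_ord_recl subn0 -addrA mulr_sumr -big_split /=; congr (_ + _).
apply: eq_bigr => i _; rewrite /bump /= add1n.
have -> : (a - i.+1 = a.-1 - i)%N by lia.
ring.
Qed.

(** For the generating series E of [e 0] and G of [sg], (1 + dz) E = 1 + lam z G and G = 1 + lam z^2
    G^2. As d = 1 + lam, (1 + lam z G)(1 + z G) = (1 + dz) G, hence G = E (1 + z G). *)
Lemma renewal a : sg a = e 0 a + \sum_(i < a) e 0 i * sg (a.-1 - i).
Proof.
elim: a => [|a IH].
  by rewrite big_ord0 addr0 e00 /sg.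
have := sum_shift (e 0) sg a; rewrite e00.
have -> : \sum_(i < a) (e 0 i.+1 + d * e 0 i) * sg (a.-1 - i) =
   \sum_(i < a) lam * (sg (a.-1 - i) * sg i).
  by apply: eq_bigr => i _; rewrite e0S; ring.
rewrite -mulr_sumr -semicircle_quadratic => E.
have E0 := e0S a; rewrite /=; move: E; set s1 := \sum_(i < a.+1) _; set s2 := \sum_(i < a) _.
move: IH; rewrite -/s2 => IH E.
have -> : s1 = 1 * sg a + sg a.+1 - d * s2 by rewrite -E; ring.
have -> : s2 = sg a - e 0 a by rewrite IH; ring.
have -> : e 0 a.+1 = lam * sg a - d * e 0 a by rewrite -E0; ring.
by rewrite dE; ring.
Qed.

(* The defect in the identity
   phi (f(X) (X + 1 - lam)) = (phi ⊗ phi) ((t f(t) - s f(s)) / (t - s))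
   for f(t) = t^(-k.+1) (t - d)^a. *)
Definition defect k a := e k a + (1 - lam) * e k.+1 a
  + \sum_(i < k) e i.+1 0 * e (k - i) a - \sum_(i < a) e k i * e 0 (a.-1 - i).

(** Multiplying the test function t^-1 (t - d)^a by t = (t - d) + d gives the polynomial (t - d)^a,
    for which the identity is lam times [renewal]. *)
Lemma defect0S a : defect 0 a.+1 + d * defect 0 a = 0.
Proof.
rewrite /defect !big_ord0 /=.
have := sum_shift (e 0) (e 0) a; rewrite e00.
have -> : \sum_(i < a) (e 0 i.+1 + d * e 0 i) * e 0 (a.-1 - i) =
   lam * \sum_(i < a) e 0 i * sg (a.-1 - i).
  rewrite (reindex_inj rev_ord_inj) mulr_sumr; apply: eq_bigr => i _ /=.
  rewrite e0S; have -> : (a.-1 - (a - i.+1) = i)%N by have := ltn_ord i; lia.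
  by have -> : (a - i.+1 = a.-1 - i)%N; [lia|ring].
move: (renewal a) (e0S a) (eS 0 a).
set s1 := \sum_(i < a) _; set s2 := \sum_(i < a.+1) _; set s3 := \sum_(i < a) _.
move=> Er E0 E1 E.
have -> : s2 = 1 * e 0 a + lam * s1 - d * s3 by rewrite -E; ring.
have -> : e 0 a.+1 = lam * sg a - d * e 0 a by rewrite -E0; ring.
have -> : e 1 a.+1 = e 0 a - d * e 1 a by rewrite -E1; ring.
rewrite Er; ring.
Qed.

(** The defect is linear in the test function, and multiplication by t = (t - d) + d lowers k. *)
Lemma defectS k a : defect k.+1 a.+1 + d * defect k.+1 a = defect k a.
Proof.
rewrite /defect /=.
have E := sum_shift (e k.+1) (e 0) a.
have E' : \sum_(i < a) (e k.+1 i.+1 + d * e k.+1 i) * e 0 (a.-1 - i) =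
    \sum_(i < a) e k i * e 0 (a.-1 - i) by apply: eq_bigr => i _; rewrite eS.
rewrite E' in E.
have E2 : \sum_(i < k.+1) e i.+1 0 * e (k.+1 - i) a.+1 =
  (\sum_(i < k) e i.+1 0 * e (k - i) a + e k.+1 0 * e 0 a)
  - d * \sum_(i < k.+1) e i.+1 0 * e (k.+1 - i) a.
  have -> : \sum_(i < k) e i.+1 0 * e (k - i) a + e k.+1 0 * e 0 a =
      \sum_(i < k.+1) e i.+1 0 * e (k - i) a by rewrite big_ord_recr /= subnn.
  rewrite mulr_sumr -sumrB; apply: eq_bigr => i _.
  rewrite subSn; last by rewrite -ltnS.
  by rewrite -(eS (k - i)); ring.
rewrite E2; move: E (eS k a) (eS k.+1 a).
set s1 := \sum_(i < a) e k.+1 i * _; set s2 := \sum_(i < a.+1) _.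
set s3 := \sum_(i < a) e k i * _; set s4 := \sum_(i < k) _; set s5 := \sum_(i < k.+1) _.
move=> E E0 E1.
have -> : s2 = e k.+1 0 * e 0 a + s3 - d * s1 by rewrite -E; ring.
have -> : e k.+1 a.+1 = e k a - d * e k.+1 a by rewrite -E0; ring.
have -> : e k.+2 a.+1 = e k.+1 a - d * e k.+2 a by rewrite -E1; ring.
ring.
Qed.

Let d0 : 0 < d. Proof. by apply: lt_trans qd; apply: mulr_gt0. Qed.
Let rho := 2 * q.
Let rho0 : 0 < rho. Proof. exact: mulr_gt0. Qed.

Lemma defect_bound k : exists2 C, 0 <= C & forall a, `|defect k a| <= C * (a.+1%:R * rho ^+ a).
Proof.
have [C0 C00 eC0] := e_bound 0.
have [Ck Ck0 eCk] := e_bound k; have [Ck1 Ck10 eCk1] := e_bound k.+1.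
have [D [D0 eD]] : exists D, 0 <= D /\
    forall a, `|\sum_(i < k) e i.+1 0 * e (k - i) a| <= D * rho ^+ a.
  have [B HB] : exists B : nat -> R,
      forall i, 0 <= B i /\ forall a, `|e i a| <= B i * rho ^+ a.
    have /choice[B HB] : forall i, exists C, 0 <= C /\ forall a, `|e i a| <= C * rho ^+ a.
      by move=> i; have [C HC1 HC2] := e_bound i; exists C.
    by exists B.
  exists (\sum_(i < k) `|e i.+1 0| * B (k - i)%N); split.
    by apply: sumr_ge0 => i _; rewrite mulr_ge0 //; have [] := HB (k - i)%N.
  move=> a; apply: le_trans (ler_norm_sum _ _ _) _; rewrite mulr_suml; apply: ler_sum => i _.
  by rewrite normrM -mulrA ler_wpM2l //; have [_] := HB (k - i)%N; apply.
(* The exponents i and a.-1 - i add up to a - 1, one less than a, whence the division by [rho]. *)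
pose F := Ck * C0 / rho.
have F0 : 0 <= F by rewrite !mulr_ge0 // invr_ge0 ltW.
have eF a : `|\sum_(i < a) e k i * e 0 (a.-1 - i)| <= F * (a%:R * rho ^+ a).
  apply: le_trans (ler_norm_sum _ _ _) _.
  have -> : F * (a%:R * rho ^+ a) = \sum_(i < a) F * rho ^+ a.
    by rewrite sumr_const card_ord -mulr_natl; ring.
  apply: ler_sum => i _; rewrite normrM.
  have -> : F * rho ^+ a = (Ck * rho ^+ i) * (C0 * rho ^+ (a.-1 - i)).
    have -> : rho ^+ a = rho * (rho ^+ i * rho ^+ (a.-1 - i)).
      by rewrite -exprD -exprS; congr (_ ^+ _); have := ltn_ord i; lia.
    by rewrite /F; field; rewrite gt_eqF.
  by apply: ler_pM.
exists (Ck + `|1 - lam| * Ck1 + D + F).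
  by rewrite !addr_ge0 // mulr_ge0.
move=> a; have r0 : 0 <= rho ^+ a by rewrite exprn_ge0 // ltW.
have a1 : 1 <= a.+1%:R :> R by rewrite ler1n.
have aa : a%:R <= a.+1%:R :> R by rewrite ler_nat.
have up C x : 0 <= C -> x <= C * rho ^+ a -> x <= C * (a.+1%:R * rho ^+ a).
  move=> C'0 xC; apply: le_trans xC _; rewrite ler_wpM2l //.
  by rewrite -[leLHS]mul1r ler_wpM2r.
rewrite /defect; apply: le_trans (ler_normB _ _) _; rewrite [leRHS]mulrDl.
apply: lerD; last first.
  apply: le_trans (eF a) _; rewrite ler_wpM2l // ler_wpM2r //.
apply: le_trans (ler_normD _ _) _; rewrite [leRHS]mulrDl; apply: lerD; last exact/up/eD.
apply: le_trans (ler_normD _ _) _; rewrite [leRHS]mulrDl; apply: lerD; first exact/up/eCk.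
rewrite normrM -mulrA ler_wpM2l //; exact/up/eCk1.
Qed.

(** Write r = s s with s < 1: one factor s^n absorbs n + 1, since (n + 1) s^n is at most the
    geometric sum 1 + ... + s^n, and the other tends to 0. *)
Lemma le0_of_geometric (x C r : R) : 0 <= C -> 0 < r < 1 ->
  (forall n, x <= C * (n.+1%:R * r ^+ n)) -> x <= 0.
Proof.
move=> C0 /andP[r0 r1] xC; pose s := Num.sqrt r.
have s0 : 0 < s by rewrite sqrtr_gt0.
have s1 : s < 1 by rewrite -[ltRHS]sqrtr1 ltr_sqrt.
have rs : r = s * s by rewrite -expr2 sqr_sqrtr // ltW.
have sn n : n.+1%:R * s ^+ n <= (1 - s)^-1.
  rewrite -[leRHS]mul1r ler_pdivlMr ?subr_gt0 //.
  apply: (@le_trans _ _ (1 - s ^+ n.+1)); last by rewrite gerBl exprn_ge0 // ltW.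
  have -> : 1 - s ^+ n.+1 = (\sum_(i < n.+1) s ^+ i) * (1 - s).
    by rewrite -opprB subrX1 -mulNr opprB mulrC.
  apply: ler_wpM2r; first by rewrite subr_ge0 ltW.
  have -> : n.+1%:R * s ^+ n = \sum_(i < n.+1) s ^+ n by rewrite sumr_const card_ord mulr_natl.
  by apply: ler_sum => i _; rewrite ler_wiXn2l // ?ltW // -ltnS.
have xs n : x <= C / (1 - s) * s ^+ n.
  apply: le_trans (xC n) _; rewrite -!mulrA ler_wpM2l //.
  by rewrite rs exprMn mulrA ler_wpM2r // exprn_ge0 // ltW.
have cv : ((fun n => C / (1 - s) * s ^+ n) @ \oo --> (C / (1 - s) * 0 : R))%classic.
  by apply: cvgM; [exact: cvg_cst|apply: cvg_expr; rewrite gtr0_norm].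
rewrite -[leRHS](mulr0 (C / (1 - s))) -(cvg_lim _ cv) //.
apply: limr_ge; first by apply: cvgP cv.
by near=> n; apply: xs.
Unshelve. all: by end_near.
Qed.

(** By induction on k the defect satisfies f(a+1) = - d f(a), so |f(a)| = d^a |f(0)|. The bound (a +
    1) rho^a with rho < d forces f(0) = 0. *)
Lemma defect0 k a : defect k a = 0.
Proof.
have H f : (forall a, f a.+1 + d * f a = 0) ->
    (exists2 C, 0 <= C & forall a, `|f a| <= C * (a.+1%:R * rho ^+ a)) -> forall a, f a = 0.
  move=> fS [C C0 fC] {}a.
  have f0 n : f n = (- d) ^+ n * f 0.
    elim: n => [|n IH]; first by rewrite expr0 mul1r.
    by rewrite exprS -mulrA -IH mulNr; apply/eqP; rewrite -addr_eq0 fS.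
  rewrite f0; suff -> : f 0 = 0 by rewrite mulr0.
  apply/eqP; rewrite -normr_le0; apply: (@le0_of_geometric _ C (rho / d)) => //.
    by rewrite divr_gt0 //= ltr_pdivrMr // mul1r.
  move=> n; have := fC n; rewrite f0 normrM normrX normrN (gtr0_norm d0).
  have -> : C * (n.+1%:R * (rho / d) ^+ n) = C * (n.+1%:R * rho ^+ n) / d ^+ n.
    by rewrite expr_div_n; ring.
  by rewrite ler_pdivlMr ?exprn_gt0 // mulrC.
elim: k a => [|k IH]; apply: H; try exact: defect_bound; first exact: defect0S.
by move=> a; rewrite defectS.
Qed.

Lemma negative_moment_quadratic k :
  (lam - 1) * e k.+1 0 = e k 0 + \sum_(i < k) e i.+1 0 * e (k - i) 0.
Proof.
have := defect0 k 0; rewrite /defect big_ord0; set s := \sum_(i < k) _ => E.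
by apply/esym/eqP; rewrite -subr_eq0 -{}E; apply/eqP; ring.
Qed.

End NegativeMoments.

(** * Moments of the free Poisson law *)

Section MarchenkoPastur.
Local Open Scope classical_set_scope.
Variables (R : realType) (lam : R).
Hypothesis lam1 : 1 < lam.
Let q := Num.sqrt lam.
Let lam0 : 0 < lam. Proof. by apply: lt_trans lam1. Qed.
Let q0 : 0 < q. Proof. by rewrite sqrtr_gt0. Qed.
Let q2 : q ^+ 2 = lam. Proof. by rewrite sqr_sqrtr // ltW. Qed.
Local Notation leb := (@lebesgue_measure R).

Lemma sin_nat_pi (n : nat) : sin (n%:R * pi) = 0 :> R.
Proof.
elim: n => [|n IH]; first by rewrite mul0r sin0.
by rewrite -natr1 mulrDl mul1r sinD IH sinpi mul0r mulr0 addr0.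
Qed.

Definition mp_curve (x : R) : R := 1 + lam + 2 * q * cos x.

(** The quotient sin(jx) / sin x is the Chebyshev polynomial of the second kind of degree j - 1 in
    cos x, for j > 0. These are orthonormal for 2/pi sin(x)^2 dx on [0, pi], and multiplication by
    [mp_curve] acts on them as the tridiagonal matrix. *)
Definition mp_integrand (n j : nat) (x : R) : R :=
  2 / pi * mp_curve x ^+ n * sin x * sin (j%:R * x).

Lemma sin_mulr_nat_continuous (j : nat) : continuous (fun x : R => sin (j%:R * x)).
Proof.
move=> x; apply: (@continuous_comp _ _ _ (fun y : R => j%:R * y)).
  exact: mulrl_continuous.
exact: continuous_sin.
Qed.

Lemma mp_curve_continuous : continuous mp_curve.
Proof.
move=> x; apply: cvgD; first exact: cvg_cst.
by apply: cvgM; [exact: cvg_cst|exact: continuous_cos].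
Qed.

Lemma mp_integrand_continuous n j : continuous (mp_integrand n j).
Proof.
move=> x; apply: cvgM; last exact: sin_mulr_nat_continuous.
apply: cvgM; last exact: continuous_sin.
apply: cvgM; first exact: cvg_cst.
apply: (@continuous_comp _ _ _ mp_curve (fun y => y ^+ n)).
  exact: mp_curve_continuous.
exact: exprn_continuous.
Qed.

Lemma mp_integrand_integrable n j :
  leb.-integrable `[0, pi] (EFin \o mp_integrand n j).
Proof.
apply: continuous_compact_integrable; first exact: segment_compact.
by apply: continuous_subspaceT; apply: mp_integrand_continuous.
Qed.

Lemma mp_integrandS n j x :
  mp_integrand n.+1 j.+1 x = (1 + lam) * mp_integrand n j.+1 x
    + q * mp_integrand n j.+2 x + q * mp_integrand n j x.
Proof.
have S1 : sin (j.+1%:R * x) = sin (j%:R * x) * cos x + cos (j%:R * x) * sin x.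
  by rewrite -natr1 mulrDl mul1r sinD.
have C1 : cos (j.+1%:R * x) = cos (j%:R * x) * cos x - sin (j%:R * x) * sin x.
  by rewrite -natr1 mulrDl mul1r cosD.
have S2 : sin (j.+2%:R * x) = sin (j.+1%:R * x) * cos x + cos (j.+1%:R * x) * sin x.
  by rewrite -natr1 mulrDl mul1r sinD.
rewrite /mp_integrand /mp_curve exprS S2 C1 S1.
have := cos2Dsin2 x; move: (cos x) (sin x) (cos (j%:R * x)) (sin (j%:R * x)).
move=> c s C S cs; apply/eqP; rewrite -subr_eq0; apply/eqP.
transitivity (q * (2 / pi * (1 + lam + 2 * q * c) ^+ n * s * S) * (c ^+ 2 + s ^+ 2 - 1)).
  by ring.
by rewrite cs subrr mulr0.
Qed.

Lemma mp_integral n k :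
  Rintegral leb `[0, pi] (mp_integrand n k.+1) = jacobi_moment (1 + lam) q n k.
Proof.
elim: n k => [|n IH] k; last first.
  have -> : mp_integrand n.+1 k.+1 = (fun x => (1 + lam) * mp_integrand n k.+1 x
    + q * mp_integrand n k.+2 x + q * mp_integrand n k x).
    by apply/funext => x; rewrite mp_integrandS.
  have I a j : leb.-integrable `[0, pi] (EFin \o (fun x => a * mp_integrand n j x)).
    by have /(integrableZl _ a) := mp_integrand_integrable n j; apply.
  have II a j b l : leb.-integrable `[0, pi]
      (EFin \o (fun x => a * mp_integrand n j x + b * mp_integrand n l x)).
    by have := integrableD _ (I a j) (I b l); apply.
  rewrite RintegralD // RintegralD //.
  rewrite !RintegralZl //; try exact: mp_integrand_integrable.
  rewrite !IH /jacobi_moment /= /jacobi; congr (_ + _).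
  case: k => [|k]; last by rewrite IH.
  rewrite (@eq_Rintegral _ _ _ leb _ (fun=> 0)) => [|x _]; last first.
    by rewrite /mp_integrand mul0r sin0 mulr0.
  by rewrite Rintegral_cst //= mul0r mulr0.
have pi0 : 0 < pi :> R := pi_gt0 R.
(* [p] is a primitive of cos(kx), with k = 0 apart; [F] comes from 2 sin x sin((k+1)x) = cos(kx) -
   cos((k+2)x). *)
pose p (x : R) : R := if k is 0 then x else sin (k%:R * x) / k%:R.
pose F (x : R) : R := pi^-1 * (p x - sin (k.+2%:R * x) / k.+2%:R).
have dsin j (x : R) :
    is_derive x 1 (fun x : R => sin (j.+1%:R * x) / j.+1%:R) (cos (j.+1%:R * x)).
  have dm : is_derive x 1 (fun x : R => j.+1%:R * x) j.+1%:R.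
    have -> : (fun x : R => j.+1%:R * x) = j.+1%:R \*: id by [].
    by apply: is_derive_eq; rewrite /GRing.scale /= mulr1.
  have dc : is_derive x 1 (fun x : R => sin (j.+1%:R * x)) (cos (j.+1%:R * x) * j.+1%:R).
    exact: (@is_derive1_comp _ sin (fun x : R => j.+1%:R * x)).
  have -> : (fun x : R => sin (j.+1%:R * x) / j.+1%:R) =
      j.+1%:R^-1 \*: (fun x : R => sin (j.+1%:R * x)).
    by apply/funext => y; rewrite mulrC.
  by apply: is_derive_eq; rewrite /GRing.scale /= mulrCA mulVf ?mulr1 // pnatr_eq0.
have dp (x : R) : is_derive x 1 p (cos (k%:R * x)).
  rewrite /p; case: (k) => [|k']; last exact: dsin.
  by rewrite mul0r cos0; apply: is_derive_id.
have dF (x : R) : is_derive x 1 F (mp_integrand 0 k.+1 x).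
  have -> : F = pi^-1 \*: (p - (fun x : R => sin (k.+2%:R * x) / k.+2%:R)) by [].
  apply: is_derive_eq; rewrite /mp_integrand expr0 mulr1 /GRing.scale /=.
  have -> : k%:R * x = k.+1%:R * x - x by rewrite -natr1; ring.
  have -> : k.+2%:R * x = k.+1%:R * x + x by rewrite -natr1; ring.
  rewrite cosB cosD; ring.
have FTC : (\int[leb]_(x in `[0%R, pi]) (mp_integrand 0 k.+1 x)%:E = (F pi)%:E - (F 0)%:E)%E.
  apply: continuous_FTC2 => //.
  - by apply: continuous_subspaceT; apply: mp_integrand_continuous.
  - have cF (x : R) : {for x, continuous F}.
      by apply/differentiable_continuous/derivable1_diffP; have := dF x.
    split=> [x _||]; first by have := dF x.
      by apply: cvg_at_right_filter; apply: cF.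
    by apply: cvg_at_left_filter; apply: cF.
  - by move=> x _; rewrite derive1E; apply: derive_val.
rewrite /Rintegral FTC /= /F /p.
case: k {p F dp dF FTC} => [|k]; rewrite ?mulr0 ?sin0 ?sin_nat_pi ?mul0r ?subr0 ?mulr0 //.
  by rewrite subr0 mulVf ?eqxx // gt_eqF.
by rewrite subr0.
Qed.

Local Notation pdf := (free_poisson_pdf lam 1).
Let a := (1 - q) ^+ 2.
Let b := (1 + q) ^+ 2.

Definition mp_weight (r : nat) (x : R) : R :=
  x ^+ r * (Num.sqrt (4 * lam - (x - (1 + lam)) ^+ 2) / (2 * pi)).

(** The radicand is (b - x)(x - a), nonpositive outside the interval, and [Num.sqrt] is 0 on
    nonpositive numbers. *)
Lemma mp_sqrt0 x : ~~ (a < x < b) -> Num.sqrt (4 * lam - (x - (1 + lam)) ^+ 2) = 0.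
Proof.
move=> xab; apply: ler0_sqrtr.
have -> : 4 * lam - (x - (1 + lam)) ^+ 2 = (b - x) * (x - a).
  by rewrite /a /b -q2; ring.
have ab : a <= b by rewrite /a /b; have := q0; nra.
move: xab; rewrite negb_and -!leNgt => /orP[xa|bx].
  by apply: mulr_ge0_le0; rewrite ?subr_ge0 ?subr_le0 // (le_trans xa).
by apply: mulr_le0_ge0; rewrite ?subr_ge0 ?subr_le0 // (le_trans ab).
Qed.

Lemma pdfE x : pdf x = (2 * pi * x)^-1 * Num.sqrt (4 * lam - (x - (1 + lam)) ^+ 2).
Proof.
rewrite /free_poisson_pdf -/q !mul1r expr1n !mulr1; case: ifPn => // /mp_sqrt0 ->.
by rewrite mulr0.
Qed.

Lemma pdf_ge0 x : 0 <= pdf x.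
Proof.
rewrite /free_poisson_pdf -/q !mul1r !mulr1; case: ifPn => // /andP[ax _].
apply: mulr_ge0; last exact: sqrtr_ge0.
have x0 : 0 < x by apply: le_lt_trans ax; apply: sqr_ge0.
by rewrite invr_ge0 ltW // mulr_gt0 // mulr_gt0 ?ltr0n ?pi_gt0.
Qed.

Lemma mp_weightE r x : x ^+ r.+1 * pdf x = mp_weight r x.
Proof.
rewrite pdfE /mp_weight; have [->|x0] := eqVneq x 0.
  rewrite mp_sqrt0 ?mul0r ?mulr0 //; apply/negP => /andP[+ _].
  by rewrite ltNge sqr_ge0.
by rewrite exprSr; have := pi_gt0 R; move: (pi : R) => p p0; field; rewrite x0 gt_eqF.
Qed.

Let a0 : 0 < a.
Proof.
rewrite /a exprn_even_gt0 //= subr_eq0 eq_sym gt_eqF //.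
by rewrite -[ltLHS]sqrtr1 ltr_sqrt.
Qed.

Lemma mp_sqrt_continuous : continuous (fun x => Num.sqrt (4 * lam - (x - (1 + lam)) ^+ 2)).
Proof.
move=> x.
apply: (@continuous_comp _ _ _ (fun x => 4 * lam - (x - (1 + lam)) ^+ 2) (@Num.sqrt R));
  last exact: sqrt_continuous.
apply: cvgB; first exact: cvg_cst.
apply: (@continuous_comp _ _ _ (fun x => x - (1 + lam)) (fun y => y ^+ 2)).
  by apply: cvgB; [exact: cvg_id|exact: cvg_cst].
exact: exprn_continuous.
Qed.

Lemma mp_weight_continuous r : continuous (mp_weight r).
Proof.
move=> x; apply: cvgM; first exact: exprn_continuous.
by apply: cvgM; [exact: mp_sqrt_continuous|exact: cvg_cst].
Qed.

Lemma pdf_continuous : continuous pdf.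
Proof.
(* The denominator 2x is replaced by x + a + |x - a| = 2 max(x, a), which stays away from 0; the two
   differ only for x < a, where the square root is 0. *)
have -> : pdf = (fun x =>
    (pi * (x + a + `|x - a|))^-1 * Num.sqrt (4 * lam - (x - (1 + lam)) ^+ 2)).
  apply/funext => x; rewrite pdfE; have [xa|ax] := leP x a.
    by rewrite mp_sqrt0 ?mulr0 // negb_and -leNgt xa.
  rewrite gtr0_norm ?subr_gt0 //; congr (_^-1 * _); ring.
move=> x; apply: cvgM; last exact: mp_sqrt_continuous.
apply: cvgV.
  rewrite mulf_neq0 ?gt_eqF ?pi_gt0 //.
  have [xa|ax] := leP x a; first by rewrite ler0_norm ?subr_le0 //; have := a0; lra.
  by rewrite gtr0_norm ?subr_gt0 //; have := a0; lra.
apply: cvgM; first exact: cvg_cst.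
apply: cvgD; first by apply: cvgD; [exact: cvg_id|exact: cvg_cst].
by apply: cvg_norm; apply: cvgB; [exact: cvg_id|exact: cvg_cst].
Qed.

Lemma pdf_measurable : measurable_fun setT pdf.
Proof. exact: (measurable_realfun.continuous_measurable_fun pdf_continuous). Qed.

(** The density is given through the measure of sets only; it therefore agrees almost everywhere
    with the Radon-Nikodym derivative, for which the change of measure is known. *)
Lemma integral_free_poisson (mu : probability (measurableTypeR R) R)
    (f : measurableTypeR R -> \bar R) :
  is_free_poisson lam 1 mu -> mu.-integrable setT f ->
  (\int[mu]_x f x = \int[leb]_x (f x * (pdf x)%:E))%E.
Proof.
move=> fp intf.
have numu : mu `<< leb.
  apply/null_content_dominatesP => U mU U0.
  rewrite fp //; apply: null_set_integral => //.
  by apply/measurable_EFinP; apply: measurable_funTS; exact: pdf_measurable.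
have ipdf : leb.-integrable setT (fun x : measurableTypeR R => (pdf x)%:E).
  apply/integrableP; split; first by apply/measurable_EFinP; exact: pdf_measurable.
  under eq_integral do rewrite /= ger0_norm ?pdf_ge0 //.
  by rewrite -fp // probability_setT ltry.
rewrite -(Radon_Nikodym_change_of_variables numu measurableT intf).
have mRN : measurable_fun setT (Radon_Nikodym (charge_of_finite_measure mu) leb).
  by apply: measurable_int; apply: Radon_Nikodym_integrable.
have mf : measurable_fun setT f by apply: measurable_int intf.
apply: ae_eq_integral => //; first exact: emeasurable_funM.
  by apply: emeasurable_funM => //; apply/measurable_EFinP; exact: pdf_measurable.
apply: ae_eqe_mul2l; apply: ae_eq_sym; apply: integral_ae_eq => // E _ mE.
by rewrite -fp // -Radon_Nikodym_integral.
Qed.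

Lemma mp_curve_derive (x : R) : is_derive x 1 mp_curve (- (2 * q * sin x)).
Proof.
have -> : mp_curve = cst (1 + lam) + (2 * q) \*: (@cos R) by [].
by apply: is_derive_eq; rewrite /GRing.scale /= add0r mulrN.
Qed.

Lemma mp_curve_derive1 : mp_curve^`() = (fun x => - (2 * q * sin x)).
Proof.
by apply/funext => x; rewrite derive1E; have := mp_curve_derive x => ?; rewrite derive_val.
Qed.

Lemma mp_weight_curve r x : 0 <= x <= pi ->
  mp_weight r (mp_curve x) * (2 * q * sin x) = lam * mp_integrand r 1 x.
Proof.
move=> x0pi; have s0 := sin_ge0_pi x0pi.
rewrite /mp_weight /mp_integrand mul1r.
have -> : 4 * lam - (mp_curve x - (1 + lam)) ^+ 2 = (2 * q * sin x) ^+ 2.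
  rewrite /mp_curve -q2; have := sin2cos2 x; move: (sin x) (cos x) => s c sc.
  by rewrite [in RHS]exprMn sc; ring.
rewrite sqrtr_sqr ger0_norm; last by rewrite !mulr_ge0 // ltW.
rewrite -q2; have := pi_gt0 R; move: (pi : R) (sin x) (mp_curve x) => p s c p0.
by field; rewrite gt_eqF.
Qed.

Lemma integral_mp_weight r :
  (\int[leb]_x (mp_weight r x)%:E = (lam * jacobi_moment (1 + lam) q r 0)%:E)%E.
Proof.
have pi0 : 0 <= pi :> R by apply/ltW/pi_gt0.
have Fpi : mp_curve pi = a by rewrite /mp_curve /a cospi -q2; ring.
have F0 : mp_curve 0 = b by rewrite /mp_curve /b cos0 -q2; ring.
have -> : (\int[leb]_x (mp_weight r x)%:E = \int[leb]_(x in `[a, b]) (mp_weight r x)%:E)%E.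
  rewrite [RHS]integral_mkcond; apply: eq_integral => x _.
  rewrite patchE; case: ifPn => //; rewrite notin_setE /= in_itv /= => /negP xab.
  rewrite /mp_weight mp_sqrt0 ?mul0r ?mulr0 //.
  by apply: contra xab => /andP[ax xb]; rewrite !ltW.
have cF' : continuous mp_curve^`().
  rewrite mp_curve_derive1 => x; apply: cvgN; apply: cvgM; first exact: cvg_cst.
  exact: continuous_sin.
(* The curve decreases with cos, from b at 0 to a at pi. *)
rewrite -Fpi -F0 integration_by_substitution_decreasing //.
- have -> : (\int[leb]_(x in `[0%R, pi])
       (((mp_weight r \o mp_curve) * - derive1 mp_curve)%R x)%:E
     = \int[leb]_(x in `[0%R, pi]) (lam * mp_integrand r 1 x)%:E)%E.
    apply: eq_integral => x; rewrite inE /= in_itv /= => x0pi; congr (_%:E).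
    by rewrite -mp_weight_curve // mp_curve_derive1 /GRing.mul /= /GRing.opp /= opprK.
  have I := mp_integrand_integrable r 1.
  under eq_integral do rewrite EFinM.
  rewrite integralZl // EFinM; congr (_ * _)%E.
  rewrite -mp_integral /Rintegral fineK //; exact: integrable_fin_num I.
- move=> x y x0 y0 xy; rewrite /mp_curve ltrD2l ltr_pM2l ?mulr_gt0 //.
  by rewrite ltr_cos.
- by apply/cvg_ex; exists (derive1 mp_curve 0); apply: cvg_at_right_filter; exact: cF'.
- by apply/cvg_ex; exists (derive1 mp_curve pi); apply: cvg_at_left_filter; exact: cF'.
- split=> [x _||]; first by have := mp_curve_derive x.
    by apply: cvg_at_right_filter; apply: mp_curve_continuous.
  by apply: cvg_at_left_filter; apply: mp_curve_continuous.
- by apply: continuous_subspaceT; apply: mp_weight_continuous.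
Qed.

Lemma free_poisson_moment (mu : probability (measurableTypeR R) R) r :
  is_free_poisson lam 1 mu ->
  mu.-integrable setT (fun t : R => (t ^+ r.+1)%:E) ->
  Rintegral mu setT (fun t : R => t ^+ r.+1) = lam * jacobi_moment (1 + lam) q r 0.
Proof.
move=> fp intf; rewrite /Rintegral integral_free_poisson //.
rewrite -[RHS]/(fine (lam * jacobi_moment (1 + lam) q r 0)%:E) -integral_mp_weight.
by congr fine; apply: eq_integral => x _; rewrite -EFinM mp_weightE.
Qed.

End MarchenkoPastur.

(** * The state on the algebra generated by X and its inverse *)

Section State.
Local Open Scope complex_scope.
Variables (R : realType) (A : cstarAlgType R) (phi : state A).
Implicit Types a b : A.

Lemma star1 : star (1 : A) = 1.
Proof. by rewrite -[LHS]mulr1 -[X in _ * X]starK -starM mulr1 starK. Qed.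

Lemma star_exp a n : star (a ^+ n) = star a ^+ n.
Proof. by elim: n => [|n IH]; [rewrite star1 | rewrite exprS starM IH exprSr]. Qed.

Lemma starZR (t : R) a : star (t%:C *: a) = t%:C *: star a.
Proof. by rewrite starZ; congr (_ *: _); apply: conjc_real. Qed.

(** Inequalities and limits take place in R; on self-adjoint elements nothing is lost, by
    [state_sa]. *)
Definition re_state a : R := complex.Re (phi a).
Local Notation psi := re_state.

Lemma re_stateD a b : psi (a + b) = psi a + psi b.
Proof. by rewrite /psi linearD raddfD. Qed.

Lemma re_stateZ (c : R) a : psi (c%:C *: a) = c * psi a.
Proof. by rewrite /psi linearZ /=; case: (phi a) => x y /=; rewrite mul0r subr0. Qed.

Lemma re_state1 : psi 1 = 1.
Proof. by rewrite /psi state1. Qed.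

Lemma state_sqr_ge0 a : star a = a -> 0 <= phi (a * a).
Proof. by move=> sa; rewrite -{1}sa state_ge0. Qed.

(** 4a = (a + 1)^2 - (a - 1)^2 is a difference of squares of self-adjoint elements, on which phi is
    nonnegative and so real. *)
Lemma state_sa a : star a = a -> phi a = (psi a)%:C.
Proof.
move=> sa.
have sqr_im b : star b = b -> complex.Im (phi (b * b)) = 0.
  by move=> /state_sqr_ge0; rewrite lecE /= => /andP[/eqP].
have i1 : complex.Im (phi ((a + 1) * (a + 1))) = 0.
  by apply: sqr_im; rewrite starD sa star1.
have i2 : complex.Im (phi ((a - 1) * (a - 1))) = 0.
  by apply: sqr_im; rewrite starD sa -scaleN1r starZ star1 rmorphN1.
have E : (a + 1) * (a + 1) - (a - 1) * (a - 1) = a *+ 4.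
  rewrite -!expr2 sqrrD1 sqrrB1 opprD addrACA subrr addr0 opprD opprK addrACA subrr add0r.
  by rewrite -mulrnDr.
have : complex.Im (phi (a *+ 4)) = 0.
  rewrite -E linearB; move: i1 i2; case: (phi _) => x1 y1; case: (phi _) => x2 y2 /= -> ->.
  by rewrite subr0.
rewrite linearMn /psi; case: (phi a) => x y; rewrite -mulr_natr.
have -> : (4%:R : R[i]) = (4%:R : R)%:C by rewrite rmorph_nat.
rewrite /= mulr0 add0r => /eqP; rewrite mulf_eq0 pnatr_eq0 orbF => /eqP ->.
by [].
Qed.

Lemma re_state_cauchy a b : star a = a -> star b = b -> a * b = b * a ->
  psi (a * b) ^+ 2 <= psi (a * a) * psi (b * b).
Proof.
move=> sa sb ab.
have quad (t : R) : 0 <= t ^+ 2 * psi (a * a) + 2 * t * psi (a * b) + psi (b * b).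
  pose c := t%:C *: a + b.
  have sc : star c = c.
    by rewrite starD starZR sa sb.
  have : 0 <= psi (c * c).
    by have := state_sqr_ge0 sc; rewrite lecE => /andP[].
  have -> : psi (c * c) =
      t * (t * psi (a * a)) + t * psi (a * b) + (t * psi (a * b) + psi (b * b)).
    rewrite -!re_stateZ -!re_stateD /c; congr (psi _).
    by rewrite mulrDl !mulrDr -!scalerAl -!scalerAr -ab.
  by congr (_ <= _); ring.
have ge0 x : star x = x -> 0 <= psi (x * x).
  by move=> /state_sqr_ge0; rewrite lecE => /andP[].
have := ge0 _ sa; rewrite le_eqVlt => /predU1P[a0|a0].
  rewrite -a0 mul0r; have [->|ab0] := eqVneq (psi (a * b)) 0; first by rewrite expr0n.
  (* The quadratic is affine here, and this t gives it the value -1. *)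
  have := quad (- (psi (b * b) + 1) / (2 * psi (a * b))); rewrite -a0 mulr0 add0r.
  have -> : 2 * (- (psi (b * b) + 1) / (2 * psi (a * b))) * psi (a * b) = - (psi (b * b) + 1).
    by field.
  lra.
(* The minimizer of the quadratic. *)
have := quad (- psi (a * b) / psi (a * a)).
have -> : (- psi (a * b) / psi (a * a)) ^+ 2 * psi (a * a) +
    2 * (- psi (a * b) / psi (a * a)) * psi (a * b) + psi (b * b) =
    (psi (a * a) * psi (b * b) - psi (a * b) ^+ 2) / psi (a * a).
  by field; rewrite gt_eqF.
by rewrite pmulr_lge0 ?invr_gt0 // subr_ge0.
Qed.

Section FreePoisson.
Variables (X Y : A) (lam : R).
Hypotheses (lam1 : 1 < lam) (sX : star X = X) (XY : X * Y = 1) (YX : Y * X = 1).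
Hypothesis fpX : free_poisson_distributed phi X lam 1.
Let q := Num.sqrt lam.
Let d := 1 + lam.
Let lam0 : 0 < lam. Proof. by apply: lt_trans lam1. Qed.
Let q0 : 0 < q. Proof. by rewrite sqrtr_gt0. Qed.
Let q2 : q ^+ 2 = lam. Proof. by rewrite sqr_sqrtr // ltW. Qed.

Lemma star_inverse : star Y = Y.
Proof.
have YsX : star Y * X = 1 by rewrite -{1}sX -starM XY star1.
by rewrite -[LHS]mulr1 -XY mulrA YsX mul1r.
Qed.

Lemma state_powerX n : phi (X ^+ n.+1) = (lam * jacobi_moment d q n 0)%:C.
Proof.
have [mu fp hX] := fpX; have [int ->] := hX n.+1 isT.
by rewrite (free_poisson_moment lam1 fp int).
Qed.

(** For n > 0 the terms j = 0 and j = n both equal phi(X^n); together with the coefficient 1 - lam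
    they account for the diagonal entry 1 + lam of the tridiagonal matrix. *)
Lemma positive_moment_quadratic n :
  phi (X ^+ n.+1) + (1 - lam%:C) * phi (X ^+ n) =
  \sum_(j < n.+1) phi (X ^+ j) * phi (X ^+ (n - j)).
Proof.
case: n => [|n].
  rewrite big_ord1 expr0 state1 state_powerX /jacobi_moment /= !mulr1; ring.
rewrite big_ord_recl big_ord_recr /= subn0 subnn expr0 state1 mul1r mulr1.
have -> : \sum_(i < n) phi (X ^+ bump 0 i) * phi (X ^+ (n.+1 - bump 0 i)) =
    (lam ^+ 2 * \sum_(i < n) jacobi_moment d q (n.-1 - i) 0 * jacobi_moment d q i 0)%:C.
  rewrite mulr_sumr rmorph_sum; apply: eq_bigr => i _; rewrite /bump add1n subSS.
  have -> : (n - i = (n.-1 - i).+1)%N by have := ltn_ord i; lia.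
  rewrite !state_powerX -rmorphM; congr (_ _); ring.
rewrite !state_powerX.
have -> : jacobi_moment d q n.+1 0 = d * jacobi_moment d q n 0
    + lam * \sum_(i < n) jacobi_moment d q (n.-1 - i) 0 * jacobi_moment d q i 0.
  case: n => [|n]; last by rewrite jacobi_moment_quadratic q2.
  by rewrite big_ord0 /jacobi_moment /= /jacobi /= !mulr0 !addr0.
set s := \sum_(i < n) _; rewrite -[1 : R[i]]/(1%:C) -rmorphB -!rmorphM -!rmorphD.
by congr (_ %:C); rewrite /= /d; ring.
Qed.

Let S := X - d%:C *: 1.

Let XS : X * S = S * X.
Proof. by rewrite /S mulrBr mulrBl -scalerAr -scalerAl mulr1 mul1r. Qed.

Let YS : Y * S = S * Y.
Proof. by rewrite /S mulrBr mulrBl -scalerAr -scalerAl mulr1 mul1r XY YX. Qed.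

Let sS : star S = S.
Proof. by rewrite /S -scaleNr -rmorphN starD starZR sX star1. Qed.

Lemma re_state_XS (j a : nat) : psi (X ^+ j.+1 * S ^+ a) =
  lam * iter j (jacobi d q) (jacobi_moment 0 q a) 0.
Proof.
pose f (j a : nat) := psi (X ^+ j.+1 * S ^+ a).
rewrite -[LHS]/(f j a); apply: jacobi_moment_shift => {j a} [j|j a]; rewrite /f.
  by rewrite mulr1 /psi state_powerX.
have XjS : X ^+ j.+1 * S = X ^+ j.+2 - d%:C *: X ^+ j.+1.
  by rewrite /S mulrBr -scalerAr mulr1 -exprSr.
rewrite (exprS S) mulrA XjS mulrBl -scalerAl re_stateD -scaleNr -rmorphN re_stateZ.
by rewrite mulNr.
Qed.

Let e (k a : nat) := psi (Y ^+ k * S ^+ a).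

Let e00 : e 0 0 = 1.
Proof. by rewrite /e !expr0 mulr1 re_state1. Qed.

Let SX : S + d%:C *: 1 = X. Proof. by rewrite /S subrK. Qed.

Let e0S (a : nat) : e 0 a.+1 + d * e 0 a = lam * jacobi_moment 0 q a 0.
Proof.
rewrite /e !expr0 !mul1r -re_stateZ -re_stateD -(re_state_XS 0) expr1.
congr (psi _); rewrite exprS -[in RHS]SX (mulrDl S).
by rewrite -scalerAl mul1r.
Qed.

Let eS (k a : nat) : e k.+1 a.+1 + d * e k.+1 a = e k a.
Proof.
rewrite /e -re_stateZ -re_stateD; congr (psi _).
have -> : S ^+ a.+1 = X * S ^+ a - d%:C *: S ^+ a.
  by rewrite exprS /S mulrBl -scalerAl mul1r.
by rewrite mulrBr scalerAr subrK mulrA [Y ^+ _]exprSr -[Y ^+ k * Y * X]mulrA YX mulr1.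
Qed.

Let e_bound k : exists2 C, 0 <= C & forall a : nat, `|e k a| <= C * (2 * q) ^+ a.
Proof.
pose B := psi (Y ^+ k.+1 * Y ^+ k.+1) * (lam * (2 * q + d)).
have r0 : 0 < 2 * q by rewrite mulr_gt0.
have cYX n : GRing.comm (Y ^+ n) X by apply/commr_sym/commrX; rewrite /GRing.comm XY YX.
have cYS n : GRing.comm (Y ^+ n) S by apply/commr_sym/commrX; rewrite /GRing.comm YS.
have cXS n : GRing.comm X (S ^+ n) by apply: commrX; rewrite /GRing.comm XS.
have ge0 x : star x = x -> 0 <= psi (x * x).
  by move=> /state_sqr_ge0; rewrite lecE => /andP[].
have sYk : star (Y ^+ k.+1) = Y ^+ k.+1 by rewrite star_exp star_inverse.
have B0 : 0 <= B.
  by rewrite !mulr_ge0 ?ge0 ?addr_ge0 // ?ltW // addr_gt0.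
have eB (a : nat) : e k a ^+ 2 <= B * ((2 * q) ^+ a) ^+ 2.
  (* The factor X is taken out of X^-k so that Cauchy-Schwarz leads to phi(X^2 S^(2a)), which has
     the positive power of X required by [re_state_XS]. *)
  have -> : e k a = psi (Y ^+ k.+1 * (X * S ^+ a)).
    by rewrite /e mulrA exprSr -[Y ^+ k * Y * X]mulrA YX mulr1.
  have sXS : star (X * S ^+ a) = X * S ^+ a by rewrite starM star_exp sS sX cXS.
  apply: le_trans (re_state_cauchy sYk sXS _) _.
    exact: (commrM (cYX _) (commrX _ (cYS _))).
  rewrite /B -[leRHS]mulrA ler_wpM2l ?ge0 //.
  have -> : X * S ^+ a * (X * S ^+ a) = X ^+ 2 * S ^+ (a + a).
    by rewrite mulrA -[X * S ^+ a * X]mulrA -cXS mulrA -expr2 -mulrA -exprD.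
  rewrite (re_state_XS 1) /= /jacobi addr0 -exprM muln2 -addnn -mulrA.
  apply: ler_wpM2l; first exact: ltW.
  have b (n k' : nat) : jacobi_moment 0 q n k' <= (2 * q) ^+ n.
    by apply: le_trans (ler_norm _) (jacobi_moment_bound _ _ (ltW q0)).
  have d0 : 0 <= d by rewrite addr_ge0 // ltW.
  have := b (a + a)%N 0%N; have := b (a + a)%N 1%N.
  have : 0 <= (2 * q) ^+ (a + a) by rewrite exprn_ge0 // ltW.
  set P := (2 * q) ^+ _; set u := jacobi_moment _ _ _ _; set v := jacobi_moment _ _ _ _.
  move=> P0 uP vP; have qu : q * u <= q * P by apply: ler_wpM2l; first exact: ltW.
  have qP : 0 <= q * P by apply: mulr_ge0 => //; exact: ltW.
  have dv : d * v <= d * P by apply: ler_wpM2l.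
  lra.
(* Only the square was bounded, and B <= (B + 1)^2. *)
exists (B + 1) => [|a]; first by rewrite addr_ge0.
have P0 : 0 <= (2 * q) ^+ a by rewrite exprn_ge0 // ltW.
rewrite -ler_sqr ?nnegrE ?mulr_ge0 ?addr_ge0 // real_normK ?num_real //.
apply: le_trans (eB a) _; rewrite [leRHS]exprMn; apply: ler_wpM2r; first exact: sqr_ge0.
nra.
Qed.

Lemma inverse_moment_quadratic n :
  (lam%:C - 1) * phi (Y ^+ n.+1) =
  phi (Y ^+ n) + \sum_(i < n) phi (Y ^+ i.+1) * phi (Y ^+ (n - i)).
Proof.
have phiY k : phi (Y ^+ k) = (e k 0)%:C.
  by rewrite /e expr0 mulr1 state_sa // star_exp star_inverse.
have qd : 2 * q < d.
  have q1 : 1 < q by rewrite -[ltLHS]sqrtr1 ltr_sqrt.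
  by rewrite /d -q2; nra.
have E := @negative_moment_quadratic R lam d q e q0 q2 erefl qd e00 e0S eS e_bound n.
rewrite !phiY -[1 : R[i]]/(1%:C) -rmorphB -rmorphM /= E rmorphD rmorph_sum; congr (_ + _).
by apply: eq_bigr => i _; rewrite !phiY -rmorphM.
Qed.

Let letter (b : bool) := if b then X else Y.
Let K (w : seq bool) := free_cumulant phi (map letter w).
Let M (w : seq bool) := word_moment phi (map letter w).

Lemma cumulant_power (Z : A) (w : seq unit) :
  phi (Z ^+ size (tt :: w)) =
  block_sum (fun v : seq unit => phi (Z ^+ size v))
    (fun v => free_cumulant phi (nseq (size (tt :: v)) Z)) (fun v => phi (Z ^+ size v)) w.
Proof.
have nseqE (v : seq unit) : map (fun=> Z) v = nseq (size v) Z.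
  by elim: v => //= _ v ->.
have momE : (fun v : seq unit => phi (Z ^+ size v)) =
    (fun v => word_moment phi (map (fun=> Z) v)).
  apply/funext => v; rewrite /word_moment nseqE; congr (phi _).
  by elim: v => [|[] v IH]; rewrite ?big_nil //= big_cons -IH exprS.
have kumE : (fun v : seq unit => free_cumulant phi (nseq (size (tt :: v)) Z)) =
    (fun v => free_cumulant phi (Z :: map (fun=> Z) v)).
  by apply/funext => v; rewrite nseqE.
rewrite momE kumE -(block_sum_map (fun=> Z) _ (fun v => free_cumulant phi (Z :: v))).
by rewrite -moment_first_block -[LHS]/((fun v : seq unit => phi (Z ^+ size v)) (tt :: w)) momE.
Qed.

Lemma cumulant_powerX n : free_cumulant phi (nseq n.+1 X) = lam%:C.
Proof.
have := @cumulant_free_poisson _ (fun v => free_cumulant phi (nseq (size v) X))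
  (fun n => phi (X ^+ n)) lam%:C (state1 phi) (cumulant_power X) positive_moment_quadratic n.
by rewrite size_nseq.
Qed.

Lemma cumulant_powerY n : (lam%:C - 1) * free_cumulant phi (nseq n.+1 Y) =
  (n == 0)%:R +
  \sum_(i < n) free_cumulant phi (nseq i.+1 Y) * free_cumulant phi (nseq (n - i) Y).
Proof.
have := @cumulant_inverse_free_poisson _ (fun v => free_cumulant phi (nseq (size v) Y))
  (fun n => phi (Y ^+ n)) lam%:C (state1 phi) (cumulant_power Y) inverse_moment_quadratic n.
rewrite size_nseq => ->; congr (_ + _).
by apply: eq_bigr => j _; rewrite !size_nseq.
Qed.

Lemma cumulant_letters (w : seq bool) : false \in w -> K w =
  if cycle not_both_true w
  then (-1) ^+ count id w * free_cumulant phi (nseq (count negb w) Y) else 0.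
Proof.
have KY n : K (nseq n false) = free_cumulant phi (nseq n Y) by rewrite /K map_nseq.
rewrite -KY; apply: (@cumulant_word _ M K lam%:C).
- by rewrite /M /word_moment big_nil state1.
- move=> a v; rewrite /M /= moment_first_block.
  by rewrite block_sum_map.
- move=> a v; rewrite /M map_rcons /word_moment big_cons /= big_rcons /=; congr (phi _).
  (* Rotation invariance of the moments comes from the commutation of X and X^-1. *)
  have : forall b : bool, letter a * letter b = letter b * letter a.
    by case: a => -[]; rewrite /letter ?XY ?YX.
  move=> ab; elim: v => [|b v IH]; first by rewrite !big_nil mulr1 mul1r.
  by rewrite /= !big_cons mulrA ab -mulrA IH mulrA.
- by move=> v; rewrite /M /word_moment !big_cons mulrA YX mul1r.
- by move=> n; rewrite /K map_nseq cumulant_powerX.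
- move=> n; rewrite KY cumulant_powerY; congr (_ + _).
  by apply: eq_bigr => j _; rewrite !KY.
Qed.

End FreePoisson.

End State.

(** * The word of the theorem *)

Lemma path_flatten (T : Type) (f : T -> nat) (s : seq T) b :
  path not_both_true b (flatten [seq false :: nseq (f k) true | k <- s]) =
  all (fun k => f k <= 1)%N s.
Proof.
elim: s b => //= k s IH b; rewrite not_both_true_false /=.
by case: (f k) => [|[|l]] //=; rewrite IH.
Qed.

Lemma count_flatten_id (T : Type) (f : T -> nat) (s : seq T) :
  count id (flatten [seq false :: nseq (f k) true | k <- s]) = sumn (map f s).
Proof.
by elim: s => //= k s IH; rewrite count_cat IH count_nseq mul1n add0n.
Qed.

Lemma count_flatten_negb (T : Type) (f : T -> nat) (s : seq T) :
  count negb (flatten [seq false :: nseq (f k) true | k <- s]) = size s.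
Proof.
by elim: s => //= k s IH; rewrite count_cat IH count_nseq mul0n add0n.
Qed.

Theorem proposition3p1 (R : realType) (A : cstarAlgType R) (phi : state A)
    (X Xinv : A) (lam : R) (m : nat) (i : 'I_m -> nat) :
  1 < lam ->
  star X = X ->
  is_inverse X Xinv ->
  free_poisson_distributed phi X lam 1 ->
  (1 <= m)%N ->
  free_cumulant phi (flatten [seq Xinv :: nseq (i k) X | k <- enum 'I_m]) =
  if [exists k : 'I_m, (1 < i k)%N] then 0
  else (-1) ^+ (\sum_(k < m) i k)%N * free_cumulant phi (nseq m Xinv).
Proof.
move=> lam1 sX [XY YX] fpX m0.
pose w := flatten [seq false :: nseq (i k) true | k <- enum 'I_m].
have -> : flatten [seq Xinv :: nseq (i k) X | k <- enum 'I_m] =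
    map (fun b : bool => if b then X else Xinv) w.
  rewrite /w map_flatten -map_comp; congr flatten; apply: eq_map => k /=.
  by rewrite map_nseq.
have [u wu] : exists u, w = false :: u.
  rewrite /w; have := size_enum_ord m; case: (enum 'I_m) => [|k s] /=.
    by move=> m'; rewrite -m' in m0.
  by move=> _; eexists.
rewrite (cumulant_letters lam1 sX XY YX fpX); last by rewrite wu inE eqxx.
have -> : cycle not_both_true w = ~~ [exists k : 'I_m, (1 < i k)%N].
  (* Since the word starts with X^-1, the cyclic condition has no content at the junction and
     becomes a condition on each run of X. *)
  rewrite wu cycle_false -[path _ _ u]/(path not_both_true false (false :: u)) -wu.
  rewrite path_flatten negb_exists; apply/allP/forallP => H k.
    by rewrite -leqNgt H // mem_enum.
  by move=> _; rewrite leqNgt H.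
rewrite count_flatten_negb size_enum_ord count_flatten_id if_neg.
by rewrite sumnE big_map -big_enum.
Qed.
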